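(* Let $1\le p,q_1,q_2<\infty$. The inclusion $F^{\alpha_1}_{p,q_1}(\gamma_d)\subset F^{\alpha_2}_{p,q_2}(\gamma_d)$ holds for $\alpha_1>\alpha_2>0$ and $q_1\ge q_2$.
   Context: $\gamma_d$ is the Gaussian probability measure on $\mathbb{R}^d$ with density $\pi^{-d/2}e^{-|x|^2}$, and $\|\cdot\|_{p,\gamma_d}$ is the norm of $L^p(\gamma_d)$. Ornstein-Uhlenbeck semigroup: $T_tf(x)=\pi^{-d/2}(1-e^{-2t})^{-d/2}\int_{\mathbb{R}^d}e^{-|y-e^{-t}x|^2/(1-e^{-2t})}f(y)\,dy$ for $t>0$, $T_0f=f$. Poisson-Hermite semigroup: $P_tf(x)=\int_0^\infty T_sf(x)\,\mu_t^{(1/2)}(ds)$ for $t>0$, where $\mu^{(1/2)}_t(ds)=\frac{t}{2\sqrt{\pi}}\frac{e^{-t^2/4s}}{s^{3/2}}ds$ on $(0,\infty)$; $P_0f=f$. Gaussian Triebel-Lizorkin spaces: let $\alpha\ge0$, $k$ the smallest integer greater than $\alpha$, $1\le p,q<\infty$. $F^{\alpha}_{p,q}(\gamma_d)$ is the set of $f\in L^p(\gamma_d)$ with $\left\|\left(\int_0^\infty\left(t^{k-\alpha}\left|\frac{\partial^kP_tf}{\partial t^k}\right|\right)^q\frac{dt}{t}\right)^{1/q}\right\|_{p,\gamma_d}<\infty$. *)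

(* Defs.v *)
From HB Require Import structures.
From mathcomp Require Import all_boot all_order all_algebra.
From mathcomp Require Import all_classical all_reals all_analysis.
From mathcomp Require Import measurable_realfun.

Set Implicit Arguments.
Unset Strict Implicit.
Unset Printing Implicit Defensive.
Import Order.TTheory GRing.Theory Num.Theory.
Import numFieldNormedType.Exports.

Local Open Scope classical_set_scope.
Local Open Scope ring_scope.

(* R^d is [d.-tuple R], which the library equips with the product sigma-algebra
   of the Borel sets of R. *)

Section tuple_cons.
Context (R : realType) (n : nat).

Definition tcons (x : R * n.-tuple R) : n.+1.-tuple R := [tuple of x.1 :: x.2].

Definition tuncons (x : n.+1.-tuple R) : R * n.-tuple R :=
  (thead x, [tuple of behead x]).

Lemma tconsK : cancel tcons tuncons.
Proof.
by move=> [x y]; rewrite /tcons /tuncons/=; congr pair; apply: val_inj.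
Qed.

Lemma tunconsK : cancel tuncons tcons.
Proof. by move=> x; rewrite /tcons/= [RHS]tuple_eta. Qed.

Lemma measurable_tcons : measurable_fun [set: R * n.-tuple R] tcons.
Proof. exact: measurable_cons. Qed.

Lemma measurable_tuncons : measurable_fun [set: n.+1.-tuple R] tuncons.
Proof.
apply/measurable_fun_pair; last exact: measurable_behead.
exact: measurable_tnth.
Qed.

End tuple_cons.

Section lebesgue_tuple_step.
Context (R : realType) (n : nat).
Variable m : {sigma_finite_measure set (n.-tuple R) -> \bar R}.

Definition lebesgue_cons : set (n.+1.-tuple R) -> \bar R :=
  pushforward (lebesgue_measure \x m)%E (@tcons R n).

Let lebesgue_cons0 : lebesgue_cons set0 = 0%E.
Proof. by rewrite /lebesgue_cons /pushforward preimage_set0 measure0. Qed.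

Let lebesgue_cons_ge0 A : (0 <= lebesgue_cons A)%E.
Proof. by rewrite /lebesgue_cons /pushforward measure_ge0. Qed.

Let lebesgue_cons_sigma_additive : semi_sigma_additive lebesgue_cons.
Proof.
move=> F mF tF mUF; rewrite /lebesgue_cons /pushforward preimage_bigcup.
apply: measure_semi_sigma_additive.
- by move=> i; rewrite -[X in measurable X]setTI; exact: measurable_tcons.
- apply/trivIsetP => /= i j _ _ ij; rewrite -preimage_setI.
  by move/trivIsetP : tF => /(_ _ _ _ _ ij) ->//; rewrite preimage_set0.
- rewrite -preimage_bigcup -[X in measurable X]setTI.
  exact: measurable_tcons.
Qed.

HB.instance Definition _ := isMeasure.Build _ _ _ lebesgue_cons
  lebesgue_cons0 lebesgue_cons_ge0 lebesgue_cons_sigma_additive.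

Let lebesgue_cons_sigma_finite : sigma_finite setT lebesgue_cons.
Proof.
have /sigma_finiteP[F [FT ndF Foo]] := sigma_finiteT (@lebesgue_measure R).
have /sigma_finiteP[G [GT ndG Goo]] := sigma_finiteT m.
exists (fun k => @tuncons R n @^-1` (F k `*` G k)).
  rewrite -preimage_bigcup (_ : \bigcup_k _ = setT) ?preimage_setT//.
  rewrite -subTset => -[x y] _.
  have [i _ Fix] : (\bigcup_i F i) x by rewrite -FT.
  have [j _ Gjy] : (\bigcup_j G j) y by rewrite -GT.
  exists (maxn i j) => //; split => /=.
  - by move: x Fix; exact/subsetPset/ndF/leq_maxl.
  - by move: y Gjy; exact/subsetPset/ndG/leq_maxr.
move=> k; have [mF Fk] := Foo k; have [mG Gk] := Goo k; split.
  rewrite -[X in measurable X]setTI; apply: measurable_tuncons => //.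
  exact: measurableX.
rewrite /lebesgue_cons /pushforward -comp_preimage.
rewrite (_ : _ \o _ = id); last by apply/funext => x; exact: tconsK.
by rewrite preimage_id product_measure1E// lte_mul_pinfty// ge0_fin_numE.
Qed.

HB.instance Definition _ := Measure_isSigmaFinite.Build _ _ _
  lebesgue_cons lebesgue_cons_sigma_finite.

Lemma ge0_integral_lebesgue_cons (f : n.+1.-tuple R -> \bar R) :
  measurable_fun setT f -> (forall x, 0 <= f x)%E ->
  (\int[lebesgue_cons]_z f z =
   \int[lebesgue_measure]_x \int[m]_y f (tcons (x, y)))%E.
Proof.
move=> mf f0.
transitivity (\int[(lebesgue_measure \x m)%E]_z (f \o @tcons R n) z)%E.
  rewrite -[in RHS](preimage_setT (@tcons R n)).
  rewrite -ge0_integral_pushforward//; first exact: measurable_tcons.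
apply: (@fubini_tonelli1 _ _ _ _ _ lebesgue_measure m (f \o @tcons R n)).
- by apply: measurableT_comp => //; exact: measurable_tcons.
- by move=> x; exact: f0.
Qed.

End lebesgue_tuple_step.

Fixpoint lebesgue_tuple (R : realType) (d : nat) :
    {sigma_finite_measure set (d.-tuple R) -> \bar R} :=
  match d with
  | 0 => dirac [tuple]
  | n.+1 => lebesgue_cons (lebesgue_tuple R n)
  end.

Section gaussian_measure.
Context (R : realType).
Local Open Scope ereal_scope.

Definition sqnorm (d : nat) (x : d.-tuple R) : R :=
  (\sum_(i < d) tnth x i ^+ 2)%R.

Definition gaussian_density (d : nat) (x : d.-tuple R) : R :=
  (pi `^ (- (d%:R / 2)) * expR (- sqnorm x))%R.

Lemma measurable_sqnorm d : measurable_fun [set: d.-tuple R] (@sqnorm d).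
Proof.
apply: measurable_sum => i; apply: measurable_funX.
exact: measurable_tnth.
Qed.

Lemma measurable_gaussian_density d :
  measurable_fun [set: d.-tuple R] (@gaussian_density d).
Proof.
apply: measurable_funM => //; apply: measurableT_comp => //.
by apply: measurableT_comp => //; exact: measurable_sqnorm.
Qed.

Lemma gaussian_density_ge0 d (x : d.-tuple R) : (0 <= gaussian_density x)%R.
Proof. by rewrite mulr_ge0 ?powR_ge0 ?expR_ge0. Qed.

Definition gaussian (d : nat) (A : set (d.-tuple R)) : \bar R :=
  \int[lebesgue_tuple R d]_(x in A) (gaussian_density x)%:E.

Section measure.
Variable d : nat.

Let gaussian0 : @gaussian d set0 = 0.
Proof. by rewrite /gaussian integral_set0. Qed.

Let gaussian_ge0 A : 0 <= @gaussian d A.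
Proof. by apply: integral_ge0 => x _; rewrite lee_fin gaussian_density_ge0. Qed.

Let gaussian_sigma_additive : semi_sigma_additive (@gaussian d).
Proof.
move=> F mF tF mUF; rewrite /gaussian ge0_integral_bigcup//.
- apply: is_cvg_ereal_nneg_natsum_cond => n _ _.
  by apply: integral_ge0 => x _; rewrite lee_fin gaussian_density_ge0.
- apply/measurable_EFinP/measurable_funTS; exact: measurable_gaussian_density.
- by move=> x _; rewrite lee_fin gaussian_density_ge0.
Qed.

HB.instance Definition _ := isMeasure.Build _ _ _ (@gaussian d)
  gaussian0 gaussian_ge0 gaussian_sigma_additive.

End measure.

Lemma sqnorm_tcons n (x : R) (y : n.-tuple R) :
  sqnorm (tcons (x, y)) = (x ^+ 2 + sqnorm y)%R.
Proof.
rewrite /sqnorm big_ord_recl tnth0; congr (_ + _)%R.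
by apply: eq_bigr => i _; rewrite tnthS.
Qed.

Lemma measurable_expR_sqnorm d :
  measurable_fun [set: d.-tuple R] (fun x => (expR (- sqnorm x))%:E).
Proof.
apply/measurable_EFinP; apply: measurableT_comp => //.
by apply: measurableT_comp => //; exact: measurable_sqnorm.
Qed.

Lemma integral_expR_sqnorm d :
  \int[lebesgue_tuple R d]_x (expR (- sqnorm x))%:E = (Num.sqrt pi ^+ d)%:E.
Proof.
elim: d => [|n IHn].
  rewrite /= integral_dirac//; last exact: measurable_expR_sqnorm.
  by rewrite diracT mul1e /sqnorm big_ord0 oppr0 expR0.
rewrite /= ge0_integral_lebesgue_cons; last 2 first.
- exact: measurable_expR_sqnorm.
- by move=> x; rewrite lee_fin expR_ge0.
transitivity (\int[lebesgue_measure]_x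
    ((gauss_fun (x : R))%:E * (Num.sqrt pi ^+ n)%:E)).
  apply: eq_integral => x _.
  under eq_integral do rewrite sqnorm_tcons opprD expRD EFinM.
  rewrite ge0_integralZl//; last exact: measurable_expR_sqnorm.
  by rewrite IHn.
rewrite ge0_integralZr//.
- by rewrite integralT_gauss -EFinM exprS.
- by apply/measurable_EFinP; exact: measurable_gauss_fun.
- by move=> x _; rewrite lee_fin expR_ge0.
Qed.

Lemma gaussian_setT d : gaussian [set: d.-tuple R] = 1.
Proof.
rewrite /gaussian; under eq_integral do rewrite EFinM.
rewrite ge0_integralZl//; last 2 first.
- exact: measurable_expR_sqnorm.
- by rewrite lee_fin powR_ge0.
rewrite integral_expR_sqnorm -EFinM; congr EFin.
rewrite -powR12_sqrt ?pi_ge0// -powR_mulrn ?powR_ge0// -powRrM.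
rewrite -powRD; last by apply/implyP => _; rewrite gt_eqF ?pi_gt0.
by rewrite mulrC addNr powRr0.
Qed.

HB.instance Definition _ (d : nat) := Measure_isProbability.Build _ _ _
  (@gaussian d) (gaussian_setT d).

End gaussian_measure.

Arguments gaussian {R} d.

(* The semigroups act on genuine functions, as do the spaces below (sets of
   Borel representatives of elements of L^p). For f in L^p(gaussian), p >= 1, the
   integrals below converge absolutely for all x and all t > 0, and their values
   do not depend on the representative of f. Negative times, where the semigroups
   are not defined, get the same value as t = 0. *)
Section semigroups.
Context (R : realType) (d : nat).
Implicit Types (f : d.-tuple R -> R) (x y : d.-tuple R) (s t : R).

Definition ornstein_uhlenbeck t f x : R :=
  if 0 < t then
    pi `^ (- (d%:R / 2)) * (1 - expR (- (2 * t))) `^ (- (d%:R / 2)) *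
    \int[lebesgue_tuple R d]_y
      (expR (- (sqnorm [tuple tnth y i - expR (- t) * tnth x i | i < d] /
                (1 - expR (- (2 * t))))) * f y)
  else f x.

(* Density of mu_t^(1/2) with respect to the Lebesgue measure on ]0, +oo[. *)
Definition subordinator_density t s : R :=
  t / (2 * Num.sqrt pi) * (expR (- (t ^+ 2 / (4 * s))) / s `^ (3 / 2)).

Definition poisson_hermite t f x : R :=
  if 0 < t then
    \int[lebesgue_measure]_(s in `]0, +oo[)
      (ornstein_uhlenbeck s f x * subordinator_density t s)
  else f x.

End semigroups.

(* [smallest_nat_gt alpha] is the smallest integer (strictly) greater than
   [alpha] only for [0 <= alpha], see [smallest_nat_gtP]. *)
Definition smallest_nat_gt (R : realType) (alpha : R) : nat :=
  (Num.truncn alpha).+1.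

Lemma smallest_nat_gtP (R : realType) (alpha : R) : 0 <= alpha ->
  alpha < (smallest_nat_gt alpha)%:R /\
  forall m : int, alpha < m%:~R -> (smallest_nat_gt alpha)%:Z <= m.
Proof.
move=> a0; split; first by have /andP[] := truncn_itv a0.
case=> n alt; first by rewrite lez_nat /smallest_nat_gt truncn_lt_nat.
by have := le_lt_trans a0 alt; rewrite ltr0z.
Qed.

Section triebel_lizorkin.
Context (R : realType) (d : nat).
Implicit Types (f : d.-tuple R -> R) (x : d.-tuple R) (alpha p q : R).

(* The derivative is only evaluated at t > 0, and the integral over t takes its
   values in [0, +oo]. *)
Definition littlewood_paley alpha q f x : \bar R :=
  let k := smallest_nat_gt alpha in
  ((\int[lebesgue_measure]_(t in `]0%R, +oo[)
      ((t `^ (k%:R - alpha) *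
        `|((fun u => poisson_hermite u f x)^`(k))%classic t|) `^ q / t)%:E)
    `^ q^-1)%E.

Definition triebel_lizorkin alpha p q : set (d.-tuple R -> R) :=
  [set f | f \in Lfun (gaussian d) p%:E /\
           (Lnorm (gaussian d) p%:E (littlewood_paley alpha q f) < +oo)%E].

End triebel_lizorkin.

Arguments triebel_lizorkin {R} d alpha p q.

(* Main.v *)
Require Import Defs.
From mathcomp Require Import all_boot all_order all_algebra.
From mathcomp Require Import all_classical all_reals all_analysis.
From mathcomp Require Import measurable_realfun ring lra.

(* Every derivative d^k/dt^k of the subordinator density is dominated by
   t^(delta-k) (s+t^2)^(-1-delta/2), so that for t >= 1 the derivatives of
   P_t f(x) are at most C t^(delta-k) G(x), where
   G(x) = int_0^oo T_s|f|(x) (1+s)^(-1-delta/2) ds. Since T_s is an average that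
   preserves the Gaussian measure, G is in L^p(gaussian), also for p = 1, where
   maximal functions are not available. This handles the part t >= 1 of the
   integral over t. On ]0, 1] the gain t^(alpha1-alpha2) and Hoelder's inequality
   pass from q1 to q2, and when the orders k of differentiation differ, the higher
   derivative is integrated from t to 1. This bounds the square function of
   (alpha2, q2) by a multiple of the one of (alpha1, q1) plus 1 plus G, at every
   point where G is finite. *)

Set Implicit Arguments.
Unset Strict Implicit.
Unset Printing Implicit Defensive.
Import Order.TTheory GRing.Theory Num.Theory.
Import numFieldNormedType.Exports.

Local Open Scope classical_set_scope.
Local Open Scope ring_scope.

(** * The Mehler kernel *)

(** For t >= 1 and equal orders k the weight t^(k-alpha2) exceeds t^(k-alpha1), so there the square
    function of (alpha1, q1) controls nothing and the decay in t has to come from f in L^p alone.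
    The parameter delta balances two needs: delta > 0 makes (1+s)^(-1-delta/2) integrable in s, with
    integral 2/delta, and delta < alpha2 makes t^((delta-alpha2) q2) integrable against dt/t at
    infinity. The bound delta <= 1 keeps the estimate of the derivatives valid as t/sqrt(s) tends to
    0, and the exponent -1-delta/2 is forced by homogeneity in t/sqrt(s). All constants are chosen
    before f and x. Points where G is infinite cost nothing: the final bound contains the same
    average of |f|^p, which is infinite there by a form of Jensen's inequality. The square function
    is nowhere shown to be measurable in x, so its norm is handled as a lower integral. *)

Section mehler.
Context (R : realType) (d : nat).
Implicit Types (s : R) (x y : d.-tuple R).
Local Notation leb := (lebesgue_tuple R d).

(* The power [-1] agrees with the inverse for [s > 0], and unlike the inverse it
   comes with a measurability lemma on the whole line. *)
Definition mehler s x y : R :=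
  pi `^ (- (d%:R / 2)) * (1 - expR (- (2 * s))) `^ (- (d%:R / 2)) *
  expR (- (sqnorm [tuple tnth y i - expR (- s) * tnth x i | i < d] *
           (1 - expR (- (2 * s))) `^ (- 1))).

Lemma mehler_ge0 s x y : 0 <= mehler s x y.
Proof. by rewrite !mulr_ge0 ?powR_ge0 ?expR_ge0. Qed.

Lemma measurable_mehler : measurable_fun [set: (R * d.-tuple R) * d.-tuple R]
  (fun z => mehler z.1.1 z.1.2 z.2).
Proof.
have ms : measurable_fun [set: (R * d.-tuple R) * d.-tuple R] (fun z => z.1.1).
  exact: measurableT_comp measurable_fst measurable_fst.
have mx (i : 'I_d) : measurable_fun [set: (R * d.-tuple R) * d.-tuple R]
    (fun z => tnth z.1.2 i).
  apply: (measurableT_comp (measurable_tnth i)).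
  exact: measurableT_comp measurable_snd measurable_fst.
have my (i : 'I_d) : measurable_fun [set: (R * d.-tuple R) * d.-tuple R]
    (fun z => tnth z.2 i).
  exact: (measurableT_comp (measurable_tnth i)).
have mv : measurable_fun [set: (R * d.-tuple R) * d.-tuple R]
    (fun z => 1 - expR (- (2 * z.1.1))).
  apply: measurable_funB => //; apply: measurableT_comp => //.
  by apply: measurableT_comp => //; exact: measurable_funM.
apply: measurable_funM.
  apply: measurable_funM => //.
  exact: (measurableT_comp (measurable_powR _)).
apply: measurableT_comp => //; apply: measurableT_comp => //.
apply: measurable_funM.
  apply: measurable_sum => i; apply: measurable_funX.
  under eq_fun do rewrite tnth_mktuple.
  apply: measurable_funB => //; apply: measurable_funM => //.
  by apply: measurableT_comp => //; exact: measurableT_comp.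
exact: (measurableT_comp (measurable_powR _)).
Qed.

Lemma measurable_mehlerr s x : measurable_fun setT (mehler s x).
Proof.
exact: (measurableT_comp measurable_mehler (measurable_pair1 (s, x))).
Qed.

End mehler.

Lemma onem_expR_gt0 (R : realType) (s : R) : 0 < s -> 0 < 1 - expR (- (2 * s)).
Proof. by move=> s0; rewrite subr_gt0 expR_lt1 oppr_lt0 mulr_gt0. Qed.

Lemma sqrt_powR (R : realType) (a : R) (d : nat) : 0 <= a ->
  Num.sqrt a ^+ d = a `^ (d%:R / 2).
Proof.
move=> a0; rewrite -powR12_sqrt// -powR_mulrn ?powR_ge0// -powRrM.
by rewrite mulrC.
Qed.

Lemma integral_gauss_shift (R : realType) (m v : R) : 0 < v ->
  (\int[lebesgue_measure]_y (expR (- ((y - m) ^+ 2 * v `^ (-1))))%:E =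
   (Num.sqrt (pi * v))%:E)%E.
Proof.
move=> v0.
(* A normal density of variance [v / 2] has exponent -(y-m)^2/v. *)
have s0 : Num.sqrt (v / 2) != 0 by rewrite gt_eqF// sqrtr_gt0 divr_gt0.
have := @integral_normal_pdf R m (Num.sqrt (v / 2)).
have E y : normal_pdf m (Num.sqrt (v / 2)) y =
   (Num.sqrt (pi * v))^-1 * expR (- ((y - m) ^+ 2 * v `^ (-1))).
  rewrite /normal_pdf (negbTE s0) /normal_peak /normal_fun.
  rewrite sqr_sqrtr ?divr_ge0 ?ltW//.
  congr (_ * _).
    by congr (_^-1); congr Num.sqrt; rewrite -mulr_natr; field.
  by congr expR; rewrite powR_inv1 ?ltW// -mulr_natr; field; rewrite gt_eqF.
under eq_integral do rewrite E EFinM.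
rewrite ge0_integralZl//; last first.
  apply/measurable_EFinP; apply: measurableT_comp => //.
  apply: measurableT_comp => //; apply: measurable_funM => //.
  by apply: measurable_funX; exact: measurable_funB.
have pv : Num.sqrt (pi * v) != 0 by rewrite gt_eqF// sqrtr_gt0 mulr_gt0 ?pi_gt0.
move=> /(congr1 (fun z => (Num.sqrt (pi * v))%:E * z)%E).
by rewrite muleA -EFinM divff// mul1e mule1.
Qed.

Lemma integral_gauss_tuple (R : realType) (d : nat) (m : d.-tuple R) (c v : R) :
  0 < v ->
  (\int[lebesgue_tuple R d]_y
    (expR (- (sqnorm [tuple tnth y i - c * tnth m i | i < d] * v `^ (-1))))%:E =
   ((pi * v) `^ (d%:R / 2))%:E)%E.
Proof.
move=> v0; rewrite -sqrt_powR ?mulr_ge0 ?pi_ge0 ?ltW//.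
have mea k (m' : k.-tuple R) : measurable_fun setT (fun y : k.-tuple R =>
    (expR (- (sqnorm [tuple tnth y i - c * tnth m' i | i < k] *
       v `^ (-1))))%:E).
  apply/measurable_EFinP; apply: measurableT_comp => //.
  apply: measurableT_comp => //; apply: measurable_funM => //.
  apply: measurable_sum => i; apply: measurable_funX.
  under eq_fun do rewrite tnth_mktuple.
  by apply: measurable_funB => //; exact: measurable_tnth.
elim: d m => [m|n IHn m].
  rewrite /= integral_dirac; [|exact: measurableT|exact: mea].
  by rewrite diracT mul1e /sqnorm big_ord0 mul0r oppr0 expR0.
rewrite /= ge0_integral_lebesgue_cons; last 2 first.
- exact: mea.
- by move=> y; rewrite lee_fin expR_ge0.
transitivity (\int[lebesgue_measure]_x
    ((expR (- ((x - c * thead m) ^+ 2 * v `^ (-1))))%:E *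
     (Num.sqrt (pi * v) ^+ n)%:E))%E.
  apply: eq_integral => x _.
  rewrite -(IHn [tuple of behead m]) -ge0_integralZl//; last first.
    exact: mea.
  apply: eq_integral => y _; rewrite -EFinM -expRD; congr (expR _)%:E.
  rewrite -opprD -mulrDl; congr (- (_ * _)).
  rewrite /sqnorm big_ord_recl !tnth_mktuple tnth0; congr (_ + _).
  apply: eq_bigr => i _; rewrite !tnth_mktuple tnthS.
  by rewrite [in tnth m _](tuple_eta m) tnthS.
rewrite ge0_integralZr//.
- by rewrite integral_gauss_shift// -EFinM exprS.
- apply/measurable_EFinP; apply: measurableT_comp => //.
  apply: measurableT_comp => //; apply: measurable_funM => //.
  by apply: measurable_funX; exact: measurable_funB.
Qed.

Section mehler_theory.
Context (R : realType) (d : nat).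
Implicit Types (s : R) (x y : d.-tuple R).
Local Notation leb := (lebesgue_tuple R d).

Lemma integral_mehler s x : 0 < s -> (\int[leb]_y (mehler s x y)%:E = 1)%E.
Proof.
move=> s0; rewrite /mehler; under eq_integral do rewrite EFinM.
rewrite ge0_integralZl//.
- have v0 := onem_expR_gt0 s0.
  rewrite integral_gauss_tuple// -EFinM; congr EFin.
  rewrite -powRM ?pi_ge0 ?ltW// -powRD ?addNr ?powRr0//.
  by apply/implyP => _; rewrite gt_eqF// mulr_gt0 ?pi_gt0.
- apply/measurable_EFinP; apply: measurableT_comp => //.
  apply: measurableT_comp => //; apply: measurable_funM => //.
  apply: measurable_sum => i; apply: measurable_funX.
  under eq_fun do rewrite tnth_mktuple.
  by apply: measurable_funB => //; exact: measurable_tnth.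
- by rewrite lee_fin mulr_ge0 ?powR_ge0.
Qed.

(** Reversibility of the semigroup: on both sides the exponent is -(|x|^2 + |y|^2 - 2 e^(-s) x.y) /
    (1 - e^(-2s)), which is symmetric in x and y. *)
Lemma mehlerC s x y : 0 < s ->
  gaussian_density x * mehler s x y = gaussian_density y * mehler s y x.
Proof.
move=> s0; have v0 := onem_expR_gt0 s0.
rewrite /gaussian_density /mehler.
rewrite mulrACA [RHS]mulrACA -!expRD; congr (_ * expR _).
rewrite powR_inv1 ?ltW//; apply/eqP; rewrite -!opprD eqr_opp; apply/eqP.
rewrite /sqnorm !mulr_suml -!big_split/=; apply: eq_bigr => i _.
rewrite !tnth_mktuple.
(* Turns e^(-2s) into a product of two e^(-s), so that [field] sees a single exponential. *)
have -> : - (2 * s) = - s + - s by ring.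
rewrite expRD.
move: v0; have -> : - (2 * s) = - s + - s by ring.
rewrite expRD => v0.
by field; rewrite gt_eqF.
Qed.

End mehler_theory.

(** * Averages of the Ornstein-Uhlenbeck semigroup *)

Section gaussian_integral.
Context (R : realType) (d : nat).
Local Open Scope ereal_scope.
Local Notation leb := (lebesgue_tuple R d).
Local Notation gamma := (gaussian (R := R) d).

(** Change of variables goes through the Radon-Nikodym derivative, which agrees almost everywhere
    with [gaussian_density] because both have the same integral over every measurable set. *)
Lemma ge0_integral_gaussian (g : d.-tuple R -> \bar R) :
  measurable_fun setT g -> (forall x, 0 <= g x) ->
  \int[gamma]_x g x = \int[leb]_x (g x * (gaussian_density x)%:E).
Proof.
move=> mg g0.
have dom : gamma `<< leb.
  move=> N N0 A mA AN; have := N0 A mA AN => A0.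
  change (\int[leb]_(x in A) (gaussian_density x)%:E = 0).
  apply: null_set_integral => //; apply: measurable_funTS.
  by apply/measurable_EFinP; exact: measurable_gaussian_density.
rewrite -(Radon_Nikodym_SigmaFinite.change_of_variables dom)//.
have fI := Radon_Nikodym_SigmaFinite.f_integrable dom.
have md : measurable_fun setT (fun x : d.-tuple R => (gaussian_density x)%:E).
  by apply/measurable_EFinP; exact: measurable_gaussian_density.
apply: ge0_ae_eq_integral => //.
- by apply: emeasurable_funM => //; exact: measurable_int fI.
- exact: emeasurable_funM.
- by move=> x _; rewrite mule_ge0//; exact: Radon_Nikodym_SigmaFinite.f_ge0.
- by move=> x _; rewrite mule_ge0// lee_fin gaussian_density_ge0.
- apply: ae_eqe_mul2l.
  apply: integral_ae_eq => // E _ mE.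
  by rewrite -Radon_Nikodym_SigmaFinite.f_integral.
Qed.

End gaussian_integral.

Section positive_ou.
Context (R : realType) (d : nat).
Local Open Scope ereal_scope.
Local Notation leb := (lebesgue_tuple R d).
Local Notation mu := (@lebesgue_measure R).
Local Notation gamma := (gaussian (R := R) d).
Implicit Types (g : d.-tuple R -> R) (s : R) (x y : d.-tuple R).

(** T_s g for nonnegative g, with values in [0, +oo], so that Tonelli's theorem applies before any
    convergence is known. *)
Definition ou_ge0 g s x : \bar R := \int[leb]_y (g y * mehler s x y)%:E.

Lemma measurable_mehlerM g : measurable_fun setT g ->
  measurable_fun [set: (R * d.-tuple R) * d.-tuple R]
    (fun z => (g z.2 * mehler z.1.1 z.1.2 z.2)%:E).
Proof.
move=> mg; apply/measurable_EFinP; apply: measurable_funM.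
  exact: measurableT_comp.
exact: measurable_mehler.
Qed.

Variable g : d.-tuple R -> R.
Hypotheses (mg : measurable_fun setT g) (g0 : forall y, (0 <= g y)%R).

Lemma ou_ge0_ge0 s x : 0 <= ou_ge0 g s x.
Proof. by apply: integral_ge0 => y _; rewrite lee_fin mulr_ge0 ?mehler_ge0. Qed.

Lemma measurable_ou_ge0 :
  measurable_fun [set: R * d.-tuple R] (fun z => ou_ge0 g z.1 z.2).
Proof.
apply: (@measurable_fun_fubini_tonelli_F _ _ _ _ _ leb
  (fun z : (R * d.-tuple R) * d.-tuple R =>
     (g z.2 * mehler z.1.1 z.1.2 z.2)%:E)).
  exact: measurable_mehlerM.
by move=> z; rewrite lee_fin mulr_ge0 ?mehler_ge0.
Qed.

(** Invariance of the Gaussian measure: [mehlerC] exchanges the arguments of the kernel, Tonelli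
    exchanges the integrals, and the inner integral becomes the total mass 1 of the kernel. *)
Lemma integral_ou_ge0 s : (0 < s)%R ->
  \int[gamma]_x ou_ge0 g s x = \int[gamma]_y (g y)%:E.
Proof.
move=> s0.
have mdens : measurable_fun setT (@gaussian_density R d).
  exact: measurable_gaussian_density.
rewrite ge0_integral_gaussian//; last 2 first.
- exact: (measurableT_comp measurable_ou_ge0 (measurable_pair1 s)).
- by move=> x; exact: ou_ge0_ge0.
rewrite ge0_integral_gaussian//; last exact/measurable_EFinP.
transitivity (\int[leb]_x \int[leb]_y
    (gaussian_density y * g y * mehler s y x)%:E).
  apply: eq_integral => x _; rewrite muleC -ge0_integralZl//; last 3 first.
  - by apply: (measurableT_comp (measurable_mehlerM mg) (measurable_pair1 (s, x))).
  - by move=> y _; rewrite lee_fin mulr_ge0 ?mehler_ge0.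
  - by rewrite lee_fin gaussian_density_ge0.
  apply: eq_integral => y _; rewrite -EFinM; congr EFin.
  by rewrite mulrCA mehlerC//; ring.
rewrite (@fubini_tonelli _ _ _ _ _ leb leb
  (fun z => (gaussian_density z.2 * g z.2 * mehler s z.2 z.1)%:E))/=; last 2 first.
- apply/measurable_EFinP; apply: measurable_funM.
    by apply: measurable_funM; exact: measurableT_comp.
  have mp : measurable_fun [set: d.-tuple R * d.-tuple R]
     (fun z => ((s, z.2), z.1)).
    by apply/measurable_fun_pair => //; exact/measurable_fun_pair.
  exact: (measurableT_comp (@measurable_mehler R d) mp).
- move=> z /=; rewrite lee_fin; apply: mulr_ge0; last exact: mehler_ge0.
  by rewrite mulr_ge0 ?gaussian_density_ge0.
apply: eq_integral => y _; under eq_integral do rewrite EFinM.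
rewrite ge0_integralZl//.
- by rewrite integral_mehler// mule1 mulrC EFinM.
- by apply/measurable_EFinP; exact: measurable_mehlerr.
- by move=> x _; rewrite lee_fin mehler_ge0.
- by rewrite lee_fin mulr_ge0 ?gaussian_density_ge0.
Qed.

Section subordination.
Variable K : R -> R.
Hypotheses (mK : measurable_fun setT K) (K0 : forall s, (0 <= K s)%R).
Hypothesis Kle0 : forall s, (s <= 0)%R -> K s = 0%R.

(** The integral runs over the whole line; the weights [K] vanish for s <= 0, where [mehler] need
    not be a probability kernel. *)
Definition ou_avg x : \bar R := \int[mu]_s (ou_ge0 g s x * (K s)%:E).

Lemma measurable_ou_avg_integrand :
  measurable_fun [set: d.-tuple R * R] (fun z => ou_ge0 g z.2 z.1 * (K z.2)%:E).
Proof.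
apply: emeasurable_funM.
  have mp : measurable_fun [set: d.-tuple R * R] (fun z => (z.2, z.1)).
    exact/measurable_fun_pair.
  exact: (measurableT_comp measurable_ou_ge0 mp).
exact/measurable_EFinP/measurableT_comp.
Qed.

Lemma ou_avg_ge0 x : 0 <= ou_avg x.
Proof. by apply: integral_ge0 => s _; rewrite mule_ge0 ?ou_ge0_ge0 ?lee_fin. Qed.

Lemma measurable_ou_avg : measurable_fun setT ou_avg.
Proof.
apply: (@measurable_fun_fubini_tonelli_F _ _ _ _ _ mu
  (fun z : d.-tuple R * R => ou_ge0 g z.2 z.1 * (K z.2)%:E)).
  exact: measurable_ou_avg_integrand.
by move=> z; rewrite mule_ge0 ?ou_ge0_ge0 ?lee_fin.
Qed.

(** By Tonelli and invariance each s contributes K(s) times the same integral of g. With g = |f|^p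
    this puts the average of |f|^p in L^1, for p = 1 as well. *)
Lemma integral_ou_avg :
  \int[gamma]_x ou_avg x = (\int[mu]_s (K s)%:E) * \int[gamma]_y (g y)%:E.
Proof.
rewrite /ou_avg (@fubini_tonelli _ _ _ _ _ gamma mu
  (fun z : d.-tuple R * R => ou_ge0 g z.2 z.1 * (K z.2)%:E))/=; last 2 first.
- exact: measurable_ou_avg_integrand.
- by move=> z; rewrite mule_ge0 ?ou_ge0_ge0 ?lee_fin.
rewrite -ge0_integralZr//; last 3 first.
- exact/measurable_EFinP.
- by move=> s _; rewrite lee_fin.
- by apply: integral_ge0 => y _; rewrite lee_fin.
apply: eq_integral => s _; rewrite ge0_integralZr//; last 3 first.
- exact: (measurableT_comp measurable_ou_ge0 (measurable_pair1 s)).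
- by move=> x _; exact: ou_ge0_ge0.
- by rewrite lee_fin.
have [s0|s0] := ltP 0%R s; first by rewrite integral_ou_ge0// muleC.
by rewrite Kle0// mule0 mul0e.
Qed.

End subordination.

End positive_ou.

(** For a > l, a = a^(1-p) a^p <= l^(1-p) a^p since 1 - p <= 0. The bound is affine in a^p, so it
    can be integrated against any kernel, and [l] is optimized only afterwards. *)
Lemma le_addr_powR (R : realType) (p a l : R) : 1 <= p -> 0 <= a -> 0 < l ->
  a <= l + l `^ (1 - p) * a `^ p.
Proof.
move=> p1 a0 l0; have [al|la] := leP a l.
  by rewrite (le_trans al)// lerDl mulr_ge0 ?powR_ge0.
have ap : 0 < a by exact: lt_trans la.
rewrite (@le_trans _ _ (a `^ (1 - p) * a `^ p))//.
  by rewrite -powRD ?subrK ?powRr1//; apply/implyP => _; rewrite gt_eqF.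
rewrite -[leLHS]add0r lerD ?(ltW l0)// ler_wpM2r ?powR_ge0//.
rewrite -opprB !powRN lef_pV2 ?posrE ?powR_gt0//.
by rewrite ge0_ler_powR ?nnegrE ?subr_ge0 ?(ltW l0) ?(ltW ap) ?(ltW la).
Qed.

(** * Jensen's inequality for the averages *)

Section jensen.
Context (R : realType) (d : nat).
Local Open Scope ereal_scope.
Variables (f : d.-tuple R -> R) (p : R) (K : R -> R).
Hypotheses (p1 : (1 <= p)%R) (mf : measurable_fun setT f).
Hypotheses (mK : measurable_fun setT K) (K0 : forall s, (0 <= K s)%R).
Hypothesis Kle0 : forall s, (s <= 0)%R -> K s = 0%R.
Local Notation leb := (lebesgue_tuple R d).
Local Notation mu := (@lebesgue_measure R).
Let f1 x : R := `|f x|%R.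
Let fp x := (`|f x| `^ p)%R.

Let mf1 : measurable_fun setT f1.
Proof. exact: measurableT_comp. Qed.

Let mfp : measurable_fun setT fp.
Proof. exact: (measurableT_comp (measurable_powR p)). Qed.

Lemma ou_ge0_le_powR s x l : (0 < s)%R -> (0 < l)%R ->
  ou_ge0 f1 s x <= l%:E + (l `^ (1 - p))%:E * ou_ge0 fp s x.
Proof.
(* The constant [l] is written as [l] times the mass of the kernel, so that both sides are integrals
   against it and can be compared pointwise. *)
move=> s0 l0; rewrite -[l%:E]mule1 -(integral_mehler x s0).
rewrite /ou_ge0 -ge0_integralZl//; last 3 first.
- by apply/measurable_EFinP; exact: measurable_mehlerr.
- by move=> y _; rewrite lee_fin mehler_ge0.
- by rewrite lee_fin ltW.
rewrite -ge0_integralZl//; last 3 first.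
- exact: (measurableT_comp (measurable_mehlerM mfp) (measurable_pair1 (s, x))).
- by move=> y _; rewrite lee_fin mulr_ge0 ?mehler_ge0 ?powR_ge0.
- by rewrite lee_fin powR_ge0.
rewrite -ge0_integralD//; last 4 first.
- by move=> y _; rewrite -EFinM lee_fin mulr_ge0 ?mehler_ge0 ?ltW.
- by apply: emeasurable_funM => //; by apply/measurable_EFinP; exact: measurable_mehlerr.
- by move=> y _; rewrite -EFinM lee_fin !mulr_ge0 ?mehler_ge0 ?powR_ge0.
- apply: emeasurable_funM => //.
  exact: (measurableT_comp (measurable_mehlerM mfp) (measurable_pair1 (s, x))).
apply: ge0_le_integral => //.
- by move=> y _; rewrite lee_fin mulr_ge0 ?normr_ge0 ?mehler_ge0.
- exact: (measurableT_comp (measurable_mehlerM mf1) (measurable_pair1 (s, x))).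
- apply: emeasurable_funD; apply: emeasurable_funM => //.
    by apply/measurable_EFinP; exact: measurable_mehlerr.
  exact: (measurableT_comp (measurable_mehlerM mfp) (measurable_pair1 (s, x))).
move=> y _; rewrite -!EFinM -EFinD lee_fin [X in (_ <= _ + X)%R]mulrA -mulrDl.
by apply: ler_wpM2r; [exact: mehler_ge0|apply: le_addr_powR; rewrite ?normr_ge0].
Qed.

(* Jensen's inequality up to the factor [W + 1]: integrate
   [a <= l + l^(1-p) a^p] with [l = (r + 1)^(1/p)]. *)
Lemma ou_avg_jensen x (W r : R) : \int[mu]_s (K s)%:E = W%:E ->
  ou_avg fp K x = r%:E ->
  ou_avg f1 K x <= ((W + 1) * (r + 1) `^ p^-1)%:E.
Proof.
move=> KW Gr.
have r0 : (0 <= r)%R.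
  by rewrite -lee_fin -Gr ou_avg_ge0// => y; rewrite powR_ge0.
have W0 : (0 <= W)%R by rewrite -lee_fin -KW integral_ge0// => s _; rewrite lee_fin.
set l := ((r + 1) `^ p^-1)%R.
have l0 : (0 < l)%R by apply: powR_gt0; rewrite ltr_wpDl.
have p0 : p != 0%R by rewrite gt_eqF// (lt_le_trans ltr01).
have lp : (l `^ p = r + 1)%R.
  by rewrite -powRrM mulVf// powRr1// addr_ge0.
have mI (h : d.-tuple R -> R) : measurable_fun setT h -> (forall y, (0 <= h y)%R) ->
    measurable_fun setT (fun s => ou_ge0 h s x * (K s)%:E).
  move=> mh h0; apply: emeasurable_funM; last exact/measurable_EFinP.
  have := measurable_ou_ge0 mh h0 => mo.
  exact: (measurableT_comp mo (measurable_pair2 x)).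
have fp0 y : (0 <= fp y)%R by exact: powR_ge0.
have f10 y : (0 <= f1 y)%R by exact: normr_ge0.
apply: (@le_trans _ _ (l%:E * W%:E + (l `^ (1 - p))%:E * r%:E)).
  rewrite -KW -Gr /ou_avg -ge0_integralZl//; last 3 first.
  - exact/measurable_EFinP.
  - by move=> s _; rewrite lee_fin.
  - by rewrite lee_fin ltW.
  rewrite -ge0_integralZl//; last 3 first.
  - exact: mI.
  - by move=> s _; rewrite mule_ge0 ?ou_ge0_ge0 ?lee_fin.
  - by rewrite lee_fin powR_ge0.
  rewrite -ge0_integralD//; last 4 first.
  - by move=> s _; rewrite -EFinM lee_fin mulr_ge0 ?(ltW l0).
  - by apply: emeasurable_funM => //; exact/measurable_EFinP.
  - by move=> s _; rewrite !mule_ge0 ?ou_ge0_ge0 ?lee_fin ?powR_ge0.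
  - by apply: emeasurable_funM => //; exact: mI.
  apply: ge0_le_integral => //.
  - by move=> s _; rewrite mule_ge0 ?ou_ge0_ge0 ?lee_fin.
  - exact: mI.
  - apply: emeasurable_funD; apply: emeasurable_funM => //.
      exact/measurable_EFinP.
    exact: mI.
  move=> s _; have [s0|s0] := ltP 0%R s; last by rewrite Kle0// !mule0 adde0.
  rewrite muleA -ge0_muleDl ?lee_fin ?(ltW l0)//; last first.
    by rewrite mule_ge0 ?ou_ge0_ge0 ?lee_fin ?powR_ge0.
  by rewrite lee_wpmul2r ?lee_fin// ou_ge0_le_powR.
(* Since r <= r + 1 = l^p, the second term is at most l^(1-p) l^p = l. The added 1 also keeps [l]
   positive when r = 0. *)
rewrite -!EFinM -EFinD lee_fin mulrDl mul1r (mulrC W) lerD2l.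
apply: (@le_trans _ _ (l `^ (1 - p) * l `^ p)%R).
  by rewrite ler_wpM2l ?powR_ge0// lp lerDl.
rewrite -powRD ?subrK ?powRr1 ?(ltW l0)//.
by apply/implyP => _; rewrite gt_eqF.
Qed.

End jensen.

(** * Measurability and a majorant of the Ornstein-Uhlenbeck semigroup *)

Section ornstein_uhlenbeck_theory.
Context (R : realType) (d : nat).
Local Notation leb := (lebesgue_tuple R d).

(** The integrand is signed: Tonelli gives measurability for the positive and the negative part
    separately, and the extended difference of the two remains measurable even where they are
    infinite. *)
Lemma measurable_fun_integral_section (d1 d2 : measure_display)
    (T1 : measurableType d1) (T2 : measurableType d2)
    (m2 : {sigma_finite_measure set T2 -> \bar R}) (h : T1 * T2 -> R) :
  measurable_fun setT h ->
  measurable_fun setT (fun s => \int[m2]_y (h (s, y))%:E)%E.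
Proof.
move=> mh; have mH : measurable_fun setT (EFin \o h) by exact/measurable_EFinP.
under eq_fun do rewrite integralE.
apply: emeasurable_funB.
  rewrite (_ : (fun _ => _) = fubini_F m2 ((EFin \o h)^\+)%E); last first.
    apply/funext => s; rewrite /fubini_F; apply: eq_integral => y _.
    by rewrite !funeposE.
  apply: measurable_fun_fubini_tonelli_F => //; exact: measurable_funepos.
rewrite (_ : (fun _ => _) = fubini_F m2 ((EFin \o h)^\-)%E); last first.
  apply/funext => s; rewrite /fubini_F; apply: eq_integral => y _.
  by rewrite !funenegE.
apply: measurable_fun_fubini_tonelli_F => //; exact: measurable_funeneg.
Qed.

Variables (f : d.-tuple R -> R) (x : d.-tuple R).
Hypothesis mf : measurable_fun setT f.

Lemma measurable_ornstein_uhlenbeck :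
  measurable_fun (`]0%R, +oo[ : set R) (fun s => ornstein_uhlenbeck s f x).
Proof.
pose h (z : R * d.-tuple R) : R :=
  expR (- (sqnorm [tuple tnth z.2 i - expR (- z.1) * tnth x i | i < d] *
           (1 - expR (- (2 * z.1))) `^ (- 1))) * f z.2.
pose H (s : R) : R :=
  pi `^ (- (d%:R / 2)) * (1 - expR (- (2 * s))) `^ (- (d%:R / 2)) *
  fine (\int[leb]_y (h (s, y))%:E)%E.
suff mH : measurable_fun (`]0%R, +oo[ : set R) H.
  apply: eq_measurable_fun mH.
  move=> s; rewrite inE/= in_itv/= andbT => s0; rewrite /H.
  rewrite /ornstein_uhlenbeck s0; congr (_ * fine _).
  apply: eq_integral => y _; rewrite /h/= powR_inv1// ltW//.
  exact: onem_expR_gt0.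
have mv : measurable_fun [set: R] (fun s => 1 - expR (- (2 * s))).
  apply: measurable_funB => //; apply: measurableT_comp => //.
  by apply: measurableT_comp => //; exact: measurable_funM.
apply: measurable_funTS; apply: measurable_funM.
  apply: measurable_funM => //.
  exact: (measurableT_comp (measurable_powR _)).
apply: measurableT_comp => //; apply: measurable_fun_integral_section.
apply: measurable_funM; last exact: measurableT_comp.
apply: measurableT_comp => //; apply: measurableT_comp => //.
apply: measurable_funM.
  apply: measurable_sum => i; apply: measurable_funX.
  under eq_fun do rewrite tnth_mktuple.
  apply: measurable_funB => //.
    exact: (measurableT_comp (measurable_tnth i)).
  apply: measurable_funM => //.
  by apply: measurableT_comp => //; exact: measurableT_comp.
apply: (measurableT_comp (measurable_powR _)).
exact: (measurableT_comp mv).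
Qed.

Lemma le_ornstein_uhlenbeck s : 0 < s ->
  (`|ornstein_uhlenbeck s f x|%:E <= ou_ge0 (fun y => `|f y|%R) s x)%E.
Proof.
move=> s0; rewrite /ornstein_uhlenbeck s0 /ou_ge0.
set c := (X in X * _).
have c0 : 0 <= c by rewrite mulr_ge0 ?powR_ge0.
set h := (X in (\int[_]_y X y)%R).
have mh : measurable_fun setT h.
  apply: measurable_funM => //.
  apply: measurableT_comp => //; apply: measurableT_comp => //.
  apply: measurable_funM => //; apply: measurable_sum => i.
  apply: measurable_funX; under eq_fun do rewrite tnth_mktuple.
  by apply: measurable_funB => //; exact: measurable_tnth.
rewrite normrM (ger0_norm c0) EFinM.
apply: (@le_trans _ _ (c%:E * \int[leb]_y `|h y|%:E)%E).
  rewrite lee_wpmul2l ?lee_fin// /Rintegral -abse_EFin.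
  (* The real integral is [fine] of the extended one, hence 0 when that is infinite; the inequality
     holds in either case. *)
  apply: (@le_trans _ _ `|\int[leb]_y (h y)%:E|%E).
    by case: (\int[leb]_y (h y)%:E)%E => [r| |]//=; rewrite ?normr0 ?leey.
  by apply: le_abse_integral => //; exact/measurable_EFinP.
rewrite -ge0_integralZl//; last first.
  by apply/measurable_EFinP; exact: measurableT_comp.
rewrite le_eqVlt; apply/orP; left; apply/eqP.
apply: eq_integral => y _; rewrite -EFinM; congr EFin.
rewrite /h normrM ger0_norm ?expR_ge0// /mehler -/c powR_inv1.
  by rewrite mulrA [RHS]mulrC.
by rewrite ltW// onem_expR_gt0.
Qed.

End ornstein_uhlenbeck_theory.

(** * Integrals of powers *)

Lemma is_derive_powR_shift (R : realType) (a c t : R) : 0 < c + t ->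
  is_derive t 1 (fun u => (c + u) `^ a) (a * (c + t) `^ (a - 1)).
Proof.
move=> ct0; have h : is_derive t 1 (fun u => c + u) 1.
  have := is_deriveD (is_derive_cst c t 1) (is_derive_id t (1 : R)).
  by rewrite add0r.
by have := is_derive1_comp (is_derive1_powR a ct0) h; rewrite mulr1.
Qed.

Lemma is_derive_continuous (R : realType) (f : R -> R) (t df : R) :
  is_derive t 1 f df -> {for t, continuous f}.
Proof.
by case=> dft _; apply: differentiable_continuous; exact/derivable1_diffP.
Qed.

Lemma powR_shift_cvgy (R : realType) (c e : R) : 0 < e ->
  (c + t) `^ (- e) @[t --> +oo] --> 0.
Proof.
move=> e0; apply/cvgrPdist_lt => eps eps0.
near=> t.
(* The threshold solves z^(-e) = eps. *)
have ct : eps `^ (- e^-1) < c + t.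
  by rewrite -ltrBlDl; near: t; apply: nbhs_pinfty_gt; rewrite num_real.
have ct0 : 0 < c + t by rewrite (le_lt_trans _ ct)// powR_ge0.
rewrite sub0r normrN ger0_norm ?powR_ge0//.
have -> : eps = (eps `^ (- e^-1)) `^ (- e).
  by rewrite -powRrM mulrNN mulVf ?gt_eqF// powRr1// ltW.
rewrite (powRN _ e) (powRN (eps `^ _)) ltf_pV2 ?posrE; last 2 first.
- exact: powR_gt0.
- by do 2 apply: powR_gt0.
by apply: gt0_ltr_powR; rewrite ?nnegrE ?powR_ge0 ?(ltW ct0).
Unshelve. all: end_near. Qed.

Section power_integrals.
Context (R : realType).
Local Notation mu := (@lebesgue_measure R).
Implicit Types a b c e t : R.

(** The shift [c] lets one formula serve both the weight (1+s)^(-1-e) and, with c = 0, the pure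
    powers of t. *)
Lemma integral_powRy c b e : 0 < c + b -> 0 < e ->
  (\int[mu]_(t in `[b, +oo[) ((c + t) `^ (- 1 - e))%:E =
   ((c + b) `^ (- e) / e)%:E)%E.
Proof.
move=> cb0 e0.
pose F := (- e^-1) \*: (fun t => (c + t) `^ (- e)).
have ct0 t : b <= t -> 0 < c + t by move=> bt; rewrite (lt_le_trans cb0)// lerD2l.
have dF t : b <= t -> is_derive t 1 F ((c + t) `^ (- 1 - e)).
  move=> bt; have h := is_derive_powR_shift (- e) (ct0 _ bt).
  rewrite /F; apply: is_derive_eq.
  rewrite /GRing.scale/= mulrA mulrNN mulVf ?gt_eqF// mul1r.
  by congr (_ `^ _); exact: addrC.
rewrite (@ge0_continuous_FTC2y _ _ F _ 0)//.
- by rewrite sub0e /F /= /GRing.scale/= mulNr opprK mulrC.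
- by move=> t bt; exact: powR_ge0.
- apply: continuous_in_subspaceT => t; rewrite inE/= in_itv/= andbT => bt.
  exact: is_derive_continuous (is_derive_powR_shift (- 1 - e) (ct0 _ bt)).
- rewrite -[X in _ --> X](scaler0 _ (- e^-1)); apply: cvgZr.
  exact: powR_shift_cvgy.
- by move=> t bt; have [] := dF _ (ltW bt).
- by apply: cvg_at_right_filter; exact: is_derive_continuous (dF _ (lexx b)).
- move=> t; rewrite in_itv/= andbT => bt; rewrite derive1E.
  by have [_ ->] := dF _ (ltW bt).
Qed.

Lemma integral_powR01 e : 0 < e ->
  (\int[mu]_(t in `]0%R, 1%R]) (t `^ (e - 1))%:E <= (e^-1)%:E)%E.
Proof.
move=> e0.
(* The integrand may be singular at 0, so the fundamental theorem is applied on [1/(n+2), 1],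
   followed by monotone convergence. The shift by 2 keeps the left endpoint strictly below 1. *)
pose F (n : nat) : set R := `[n.+2%:R^-1, 1]%classic.
have FE : `]0%R, 1%R]%classic = \bigcup_n F n.
  apply/seteqP; split => [t|t [n _]]; rewrite ?/F /= !in_itv/=.
    move=> /andP[t0 t1]; exists (Num.truncn t^-1) => //; rewrite /F/= in_itv/= t1 andbT.
    rewrite invf_ple ?posrE//.
    by rewrite (le_trans (ltW (truncnS_gt _)))// ler_nat.
  by move=> /andP[nt ->]; rewrite andbT (lt_le_trans _ nt)// invr_gt0.
have ndF : nondecreasing_seq F.
  move=> m n mn; apply/subsetPset => t; rewrite /F /= !in_itv/= => /andP[mt ->].
  by rewrite andbT (le_trans _ mt)// lef_pV2 ?posrE// ler_nat !ltnS.
rewrite FE.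
have mG : measurable_fun setT (fun t : R => (t `^ (e - 1))%:E).
  by apply/measurable_EFinP; exact: measurable_powR.
have cvgF : (\int[mu]_(t in F n) (t `^ (e - 1))%:E @[n --> \oo] -->
    \int[mu]_(t in \bigcup_n F n) (t `^ (e - 1))%:E)%E.
  apply: ge0_nondecreasing_set_cvg_integral => //.
  - by move=> n; exact: measurable_itv.
  - by move=> n; exact: measurable_funTS.
  - by move=> n t _; rewrite lee_fin powR_ge0.
rewrite -(cvg_lim _ cvgF)//; apply: lime_le.
  by apply/cvg_ex; eexists; exact: cvgF.
apply: nearW => n; have n0 : (0 : R) < n.+2%:R^-1 by rewrite invr_gt0.
have dF t : 0 < t -> is_derive t 1 (e^-1 \*: (fun t => (0 + t) `^ e)) (t `^ (e - 1)).
  move=> t0; have t0' : 0 < 0 + t by rewrite add0r.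
  have h := is_derive_powR_shift e t0'.
  apply: is_derive_eq.
  by rewrite /GRing.scale/= mulrA mulVf ?gt_eqF// mul1r add0r.
rewrite (@continuous_FTC2 _ _ (e^-1 \*: (fun t => (0 + t) `^ e))).
- rewrite /=/GRing.scale/= !add0r powR1 mulr1 -EFinB lee_fin gerBl.
  by rewrite mulr_ge0 ?powR_ge0// invr_ge0 ltW.
- by rewrite invf_lt1// ltr1n.
- apply: continuous_in_subspaceT => t; rewrite inE/= in_itv/= => /andP[nt _].
  have t0' : 0 < 0 + t by rewrite add0r (lt_le_trans n0).
  rewrite (_ : (fun t => _) = (fun u => (0 + u) `^ (e - 1))); last first.
    by apply/funext => u; rewrite add0r.
  exact: is_derive_continuous (is_derive_powR_shift (e - 1) t0').
- split.
  + move=> t; rewrite in_itv/= => /andP[nt _].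
    by have [] := dF t (lt_trans n0 nt).
  + by apply: cvg_at_right_filter; exact: is_derive_continuous (dF _ n0).
  + by apply: cvg_at_left_filter; exact: is_derive_continuous (dF _ ltr01).
- move=> t; rewrite in_itv/= => /andP[nt _]; rewrite derive1E.
  by have [_ ->] := dF t (lt_trans n0 nt).
Qed.

End power_integrals.

(** * Derivatives of the subordinator density *)

Lemma exprn_expRN_le (R : realType) (k : nat) (w : R) : 0 <= w ->
  w ^+ k * expR (- w) <= k`!%:R.
Proof.
move=> w0; rewrite expRN ler_pdivrMr ?expR_gt0//.
case: k => [|k]; first by rewrite expr0 mul1r -expR0 ler_expR.
rewrite -ler_pdivrMl ?ltr0n ?fact_gt0// mulrC.
by rewrite (le_trans _ (expR_ge1Dxn k w0))// lerDr.
Qed.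

Lemma horner_gauss_bounded (R : realType) (p : {poly R}) :
  exists2 C, 0 <= C &
    forall z, 0 <= z -> `|p.[z]| * expR (- (z ^+ 2 / 4)) <= C.
Proof.
(* Monomial by monomial: the 1 covers z <= 1, while for z > 1, z^i <= z^(2i) = 4^i (z^2/4)^i and w^i
   e^(-w) <= i! for w = z^2/4. *)
exists (\sum_(i < size p) `|p`_i| * (1 + 4 ^+ i * i`!%:R)).
  by apply: sumr_ge0 => i _; rewrite mulr_ge0// addr_ge0// mulr_ge0// exprn_ge0.
move=> z z0; rewrite horner_coef.
apply: (@le_trans _ _ (\sum_(i < size p) `|p`_i * z ^+ i| * expR (- (z ^+ 2 / 4)))).
  by rewrite -mulr_suml ler_wpM2r ?expR_ge0// ler_norm_sum.
apply: ler_sum => i _; rewrite normrM -mulrA ler_wpM2l//.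
rewrite ger0_norm ?exprn_ge0//.
have e1 : expR (- (z ^+ 2 / 4)) <= 1.
  by rewrite -expR0 ler_expR oppr_le0 divr_ge0 ?exprn_ge0.
have w0 : 0 <= z ^+ 2 / 4 by rewrite divr_ge0// exprn_ge0.
have [z1|z1] := leP z 1.
  rewrite (@le_trans _ _ 1)//; last by rewrite lerDl mulr_ge0// exprn_ge0.
  by rewrite mulr_ile1 ?exprn_ge0 ?expR_ge0// exprn_ile1.
apply: (@le_trans _ _ (4 ^+ i * ((z ^+ 2 / 4) ^+ i * expR (- (z ^+ 2 / 4))))).
  rewrite mulrA ler_wpM2r ?expR_ge0// -exprMn mulrCA mulfV// mulr1 -exprM.
  by rewrite ler_weXn2l ?(ltW z1)// mul2n -addnn leq_addr.
rewrite -[leLHS]add0r lerD// ler_wpM2l ?exprn_ge0//.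
exact: exprn_expRN_le.
Qed.

Section subordinator_derivatives.
Context (R : realType).
Implicit Types (n : nat) (t s z : R).

(* The [n]-th derivative of [z exp(-z^2/4)] is [subord_poly n] times
   [exp(-z^2/4)]; the density is this profile at [z = t / sqrt s], up to scaling. *)
Fixpoint subord_poly n : {poly R} :=
  if n is m.+1 then (subord_poly m)^`() - (1 / 2) *: ('X * subord_poly m)
  else 'X.

Definition subord_profile n z : R := (subord_poly n).[z] * expR (- (z ^+ 2 / 4)).

(** The density is (2 sqrt(pi))^(-1) s^(-1) h(t/sqrt(s)) with h(z) = z exp(-z^2/4). Each derivative
    in t brings out another s^(-1/2), hence the exponent n + 2. *)
Definition subord_kernel n t s : R :=
  (2 * Num.sqrt pi)^-1 * (Num.sqrt s)^-1 ^+ n.+2 *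
  subord_profile n (t / Num.sqrt s).

Lemma subord_kernel0 t s : 0 < s -> subord_kernel 0 t s = subordinator_density t s.
Proof.
move=> s0; have r0 : 0 < Num.sqrt s by rewrite sqrtr_gt0.
rewrite /subord_kernel /subord_profile /= hornerX /subordinator_density.
rewrite -sqrt_powR ?ltW// -[in X in t ^+ 2 / (4 * X)](@sqr_sqrtr _ s) ?ltW//.
have -> : - ((t / Num.sqrt s) ^+ 2 / 4) = - (t ^+ 2 / (4 * Num.sqrt s ^+ 2)).
  by field; rewrite gt_eqF.
by field; rewrite !gt_eqF// sqrtr_gt0 pi_gt0.
Qed.

Lemma is_derive_subord_profile n z :
  is_derive z 1 (subord_profile n) (subord_profile n.+1 z).
Proof.
have h1 := is_derive_poly (subord_poly n) z.
have h2 : is_derive z 1 (fun z : R => - (z ^+ 2 / 4)) (- (z / 2)).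
  have -> : (fun z : R => - (z ^+ 2 / 4)) = (- (1 / 4)) \*: (id ^+ 2).
    by apply/funext => u; rewrite /= exprfctE /GRing.scale/=; field.
  by apply: is_derive_eq; rewrite /GRing.scale/= expr1; field.
have h3 := is_derive1_comp (is_derive_expR _) h2.
apply: (is_derive_eq (is_deriveM h1 h3)).
rewrite /subord_profile [subord_poly n.+1]/= /GRing.scale/= !hornerE/=.
by field.
Qed.

Lemma is_derive_subord_kernel n t s : 0 < s ->
  is_derive t 1 (subord_kernel n ^~ s) (subord_kernel n.+1 t s).
Proof.
move=> s0; have r0 : 0 < Num.sqrt s by rewrite sqrtr_gt0.
have h : is_derive t 1 (fun t : R => t / Num.sqrt s) (Num.sqrt s)^-1.
  have -> : (fun t : R => t / Num.sqrt s) = (Num.sqrt s)^-1 \*: id.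
    by apply/funext => u; rewrite /= /GRing.scale/= mulrC.
  by apply: is_derive_eq; rewrite /GRing.scale/= mulr1.
have h2 := is_derive1_comp (is_derive_subord_profile n _) h.
have h3 := is_deriveZ ((2 * Num.sqrt pi)^-1 * (Num.sqrt s)^-1 ^+ n.+2) h2.
apply: is_derive_eq h3 _.
by rewrite /subord_kernel /GRing.scale/= [in RHS]exprSr; ring.
Qed.

Lemma measurable_subord_kernel n t : measurable_fun setT (subord_kernel n t).
Proof.
have mr : measurable_fun [set: R] (fun s => (Num.sqrt s)^-1).
  have -> : (fun s : R => (Num.sqrt s)^-1) = (fun s => Num.sqrt s `^ (-1)).
    by apply/funext => s; rewrite powR_inv1// sqrtr_ge0.
  apply: (measurableT_comp (measurable_powR _)).
  exact: continuous_measurable_fun (@sqrt_continuous R).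
apply: measurable_funM.
  by apply: measurable_funM => //; exact: measurable_funX.
apply: measurable_funM.
  apply: (@measurableT_comp _ _ _ _ _ _ (horner (subord_poly n))).
    apply: continuous_measurable_fun; exact: continuous_horner.
  exact: measurable_funM.
apply: measurableT_comp => //; apply: measurableT_comp => //.
apply: measurable_funM => //; apply: measurable_funX.
exact: measurable_funM.
Qed.

(** At infinity the Gaussian factor beats every power. Near 0, z^(dl-n) >= 1 for n >= 1 because dl
    <= 1, and for n = 0 the profile is at most z <= z^dl. *)
Lemma subord_profile_bound n (dl : R) : 0 < dl <= 1 ->
  exists2 C, 0 <= C & forall z, 0 < z ->
    `|subord_profile n z| <= C * (z `^ (dl - n%:R) * (1 + z ^+ 2) `^ (- 1 - dl / 2)).
Proof.
move=> /andP[dl0 dl1].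
(* The first two factors absorb the inverse of the bound: 1 + z^n beats z^(n-dl), and (1+z^2)^2
   beats (1+z^2)^(1+dl/2). For n = 0 the polynomial ['X] is left out: keeping it would require 1 <=
   (1+z) z^dl, which fails near 0, whereas z <= (1+z) z^dl holds. *)
pose p : {poly R} := (1 + 'X^(maxn n 1)) * (1 + 'X^2) ^+ 2 *
  (if n is 0%N then 1 else subord_poly n).
have [C C0 hC] := horner_gauss_bounded p.
exists C => // z z0.
have z21 : 1 <= 1 + z ^+ 2 by rewrite lerDl exprn_ge0// ltW.
have z20 : 0 < 1 + z ^+ 2 by rewrite (lt_le_trans ltr01).
have A : 0 < z `^ (dl - n%:R) * (1 + z ^+ 2) `^ (- 1 - dl / 2).
  by rewrite mulr_gt0// powR_gt0.
rewrite -ler_pdivrMr//; apply: le_trans (hC z (ltW z0)).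
rewrite ler_pdivrMr// /subord_profile normrM [X in _ * X <= _]ger0_norm ?expR_ge0//.
rewrite [leRHS]mulrAC ler_wpM2r ?expR_ge0//.
have F1 : 1 <= (1 + z ^+ 2) ^+ 2 * (1 + z ^+ 2) `^ (- 1 - dl / 2).
  rewrite -powR_mulrn ?(ltW z20)// -powRD; last first.
    by apply/implyP => _; rewrite gt_eqF.
  by rewrite -[leLHS](powRr0 (1 + z ^+ 2)) ler_powR//; lra.
have F2 : `|(subord_poly n).[z]| <=
    (1 + z ^+ maxn n 1) * `|(if n is 0%N then 1 else subord_poly n).[z]| *
    z `^ (dl - n%:R).
  case: n {p hC A} => [|n] /=.
    rewrite hornerX hornerC normr1 mulr1 subr0 (ger0_norm (ltW z0)) expr1.
    have [z1|z1] := leP z 1.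
      apply: (@le_trans _ _ (1 * z `^ dl)).
        by rewrite mul1r -[leLHS]powRr1 ?(ltW z0)// ger_powR// z0.
      by rewrite ler_wpM2r ?powR_ge0// lerDl ltW.
    apply: (@le_trans _ _ ((1 + z) * 1)); first by rewrite mulr1 lerDr.
    rewrite ler_wpM2l ?addr_ge0 ?(ltW z0)//.
    by rewrite -[leLHS](powRr0 z) ler_powR ?(ltW z1)// ltW.
  rewrite [_ * `|_|]mulrC -mulrA -[leLHS]mulr1 ler_wpM2l//.
  have -> : maxn n.+1 1 = n.+1 by exact/maxn_idPl.
  have [z1|z1] := leP z 1.
    apply: (@le_trans _ _ (1 * z `^ (dl - n.+1%:R))).
      rewrite mul1r -[leLHS](powRr0 z) ger_powR ?z0//.
      by rewrite subr_le0 (le_trans dl1)// ler1n.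
    by rewrite ler_wpM2r ?powR_ge0// lerDl exprn_ge0// ltW.
  rewrite powRD; last by apply/implyP => _; rewrite gt_eqF.
  rewrite powRN powR_mulrn ?(ltW z0)//.
  apply: (@le_trans _ _ (z ^+ n.+1 * (z `^ dl * (z ^+ n.+1)^-1))).
    rewrite mulrCA divff ?mulr1 ?expf_neq0 ?gt_eqF//.
    by rewrite -[leLHS](powRr0 z) ler_powR ?(ltW z1)// ltW.
  apply: ler_wpM2r; last by rewrite lerDr.
  by rewrite mulr_ge0 ?powR_ge0// invr_ge0 exprn_ge0// ltW.
rewrite /p hornerM hornerM horner_exp !hornerD !hornerXn !hornerC normrM normrM.
rewrite [X in X * _ * _]ger0_norm ?addr_ge0 ?exprn_ge0 ?(ltW z0)//.
rewrite [X in _ * X * _]ger0_norm ?exprn_ge0 ?(ltW z20)//.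
apply: le_trans F2 _; rewrite -[leLHS]mulr1.
set a := `|_|; rewrite [leRHS](_ : _ = (1 + z ^+ maxn n 1) * a * z `^ (dl - n%:R) *
  ((1 + z ^+ 2) ^+ 2 * (1 + z ^+ 2) `^ (- 1 - dl / 2))); last by ring.
apply: ler_wpM2l F1; apply: mulr_ge0; last exact: powR_ge0.
apply: mulr_ge0; last exact: normr_ge0.
by rewrite addr_ge0// exprn_ge0// ltW.
Qed.

(** The profile bound at z = t/sqrt(s): the powers of s coming from s^(-(n+2)/2), z^(dl-n) and
    (1+z^2)^(-1-dl/2) cancel exactly. *)
Lemma subord_kernel_bound n (dl : R) : 0 < dl <= 1 ->
  exists2 C, 0 <= C & forall t s, 0 < t -> 0 < s ->
    `|subord_kernel n t s| <= C * (t `^ (dl - n%:R) * (s + t ^+ 2) `^ (- 1 - dl / 2)).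
Proof.
move=> dl01; have [C C0 hC] := subord_profile_bound n dl01.
exists ((2 * Num.sqrt pi)^-1 * C).
  by rewrite mulr_ge0// invr_ge0 mulr_ge0// sqrtr_ge0.
move=> t s t0 s0; have r0 : 0 < Num.sqrt s by rewrite sqrtr_gt0.
have z0 : 0 < t / Num.sqrt s by rewrite divr_gt0.
have c0 : 0 <= (2 * Num.sqrt pi)^-1 :> R by rewrite invr_ge0 mulr_ge0// sqrtr_ge0.
have r20 : 0 <= (Num.sqrt s)^-1 ^+ n.+2 by rewrite exprn_ge0// invr_ge0 ltW.
rewrite /subord_kernel normrM (ger0_norm (mulr_ge0 c0 r20)) -[leLHS]mulrA -[leRHS]mulrA.
apply: ler_wpM2l => //; apply: le_trans (ler_wpM2l r20 (hC _ z0)) _.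
rewrite mulrCA ler_wpM2l//.
have -> : s + t ^+ 2 = Num.sqrt s ^+ 2 * (1 + (t / Num.sqrt s) ^+ 2).
  rewrite -[in LHS](@sqr_sqrtr _ s) ?(ltW s0)//; field.
  by rewrite gt_eqF.
have -> : t `^ (dl - n%:R) =
    (Num.sqrt s) `^ (dl - n%:R) * (t / Num.sqrt s) `^ (dl - n%:R).
  by rewrite -powRM ?(ltW r0) ?(ltW z0)// mulrC divfK// gt_eqF.
have z20 : 0 <= 1 + (t / Num.sqrt s) ^+ 2 by rewrite addr_ge0// exprn_ge0// ltW.
have s20 : 0 <= Num.sqrt s ^+ 2 by rewrite exprn_ge0// ltW.
rewrite (powRM _ s20 z20).
rewrite [leRHS]mulrACA ler_wpM2r ?mulr_ge0 ?powR_ge0//.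
rewrite -(powR_mulrn 2 (ltW r0)) -powRrM -powRD; last first.
  by apply/implyP => _; rewrite gt_eqF.
rewrite -(powR_inv1 (ltW r0)) -(powR_mulrn n.+2) ?powR_ge0// -powRrM.
rewrite le_eqVlt; apply/orP; left; apply/eqP; congr (_ `^ _).
by rewrite -addn2 natrD; field.
Qed.

End subordinator_derivatives.

Lemma powR_anti (R : realType) (a b r : R) : 0 < a -> a <= b -> r <= 0 ->
  b `^ r <= a `^ r.
Proof.
move=> a0 ab r0; have b0 := lt_le_trans a0 ab.
rewrite -(opprK r) (powRN b) (powRN a) lef_pV2 ?posrE ?powR_gt0//.
by apply: ge0_ler_powR; rewrite ?nnegrE ?oppr_ge0 ?(ltW a0) ?(ltW b0).
Qed.

Section decay.
Context (R : realType).
Local Notation mu := (@lebesgue_measure R).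
Implicit Types e s : R.

Definition decay e s : R := if 0 < s then (1 + s) `^ (- 1 - e) else 0.

Lemma decay_ge0 e s : 0 <= decay e s.
Proof. by rewrite /decay; case: ifPn => // _; exact: powR_ge0. Qed.

Lemma decayE e s : 0 < s -> decay e s = (1 + s) `^ (- 1 - e).
Proof. by rewrite /decay => ->. Qed.

Lemma decay_le0 e s : s <= 0 -> decay e s = 0.
Proof. by move=> s0; rewrite /decay ltNge s0. Qed.

Lemma measurable_decay e : measurable_fun setT (decay e).
Proof.
apply: measurable_fun_ifT => //.
  exact: measurable_fun_ltr.
apply: (measurableT_comp (measurable_powR _)).
exact: measurable_funD.
Qed.

Lemma integral_decay e : 0 < e -> (\int[mu]_s (decay e s)%:E = (e^-1)%:E)%E.
Proof.
move=> e0.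
transitivity (\int[mu]_(s in `]0%R, +oo[) ((1 + s) `^ (- 1 - e))%:E)%E.
  rewrite [RHS]integral_mkcond; apply: eq_integral => s _.
  rewrite /decay patchE /=; case: ifPn => s0.
    by rewrite mem_set//= in_itv/= s0.
  by rewrite memNset//= in_itv/= andbT; apply/negP.
rewrite integral_itv_obnd_cbnd.
  by rewrite integral_powRy ?addr0 ?powR1 ?mul1r.
apply/measurable_funTS/measurable_EFinP; apply: (measurableT_comp (measurable_powR _)).
exact: measurable_funD.
Qed.

End decay.

(** * Differentiation under the subordination integral *)

Section subordinated.
Context (R : realType) (dl : R).
Hypothesis dl01 : 0 < dl <= 1.
Local Notation mu := (@lebesgue_measure R).
Variable u : R -> R.
Hypothesis iu : mu.-integrable `]0, +oo[ (fun s : R => (u s * decay (dl / 2) s)%:E).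

(** Here [u s] stands for T_s f(x) at a fixed point x, and this is the candidate for the n-th
    derivative of P_t f(x) in t. *)
Definition subordinated n (t : R) : R :=
  \int[mu]_(s in `]0, +oo[) (u s * subord_kernel n t s).

Let dl0 : 0 < dl. Proof. by case/andP: dl01. Qed.
Let dl1 : dl <= 1. Proof. by case/andP: dl01. Qed.

Let measurable_u : measurable_fun (`]0, +oo[ : set R) u.
Proof.
have /integrableP[/measurable_EFinP mud _] := iu.
apply: (eq_measurable_fun
  (fun s : R => (u s * decay (dl / 2) s) * (1 + s) `^ (1 + dl / 2))).
  move=> s; rewrite inE/= in_itv/= andbT => s0.
  rewrite decayE// -mulrA -powRD ?addNKr; last first.
    by apply/implyP => _; rewrite gt_eqF// addr_gt0.
  have -> : - 1 - dl / 2 + (1 + dl / 2) = 0 by ring.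
  by rewrite powRr0 mulr1.
apply: measurable_funM => //; apply: measurable_funTS.
apply: (measurableT_comp (measurable_powR _)).
exact: measurable_funD.
Qed.

(** Rests on a^2 (1+s) <= s + t^2, valid for a <= 1 and a <= t. A small [a] gives local domination
    in t, and a = 1 gives the global bound on t >= 1. *)
Lemma subord_kernel_decay n (C : R) : 0 <= C ->
  (forall t s, 0 < t -> 0 < s -> `|subord_kernel n t s| <=
     C * (t `^ (dl - n%:R) * (s + t ^+ 2) `^ (- 1 - dl / 2))) ->
  forall a t s, 0 < a -> a <= 1 -> a <= t -> 0 < s -> `|subord_kernel n t s| <=
     C * (t `^ (dl - n%:R) * (a ^+ 2) `^ (- 1 - dl / 2)) * decay (dl / 2) s.
Proof.
move=> C0 hC a t s a0 a1 at1 s0; have t0 := lt_le_trans a0 at1.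
apply: le_trans (hC _ _ t0 s0) _.
rewrite decayE// -[leRHS]mulrA ler_wpM2l// -[leRHS]mulrA ler_wpM2l ?powR_ge0//.
rewrite -powRM; last 2 first.
- by rewrite exprn_ge0// ltW.
- by rewrite addr_ge0// ltW.
apply: powR_anti.
- by rewrite mulr_gt0 ?exprn_gt0 ?addr_gt0.
- rewrite mulrDr mulr1 addrC lerD//.
    by rewrite ler_piMl ?(ltW s0)// exprn_ile1// ltW.
  by rewrite ler_pXn2r// nnegrE ltW.
- by move: dl0; lra.
Qed.

Lemma integrable_subordinated n (t : R) : 0 < t ->
  mu.-integrable `]0, +oo[ (fun s : R => (u s * subord_kernel n t s)%:E).
Proof.
move=> t0; have [C C0 hC] := subord_kernel_bound n dl01.
pose a := Num.min 1 t.
have a0 : 0 < a by rewrite /a lt_min ltr01.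
have a1 : a <= 1 by rewrite /a ge_min lexx.
have at1 : a <= t by rewrite /a ge_min lexx orbT.
set D := C * (t `^ (dl - n%:R) * (a ^+ 2) `^ (- 1 - dl / 2)).
have D0 : 0 <= D by rewrite !mulr_ge0 ?powR_ge0.
apply: (le_integrable _ _ _ (integrableZl _ D iu)) => //.
- apply/measurable_EFinP; apply: measurable_funM => //.
  by apply: measurable_funTS; exact: measurable_subord_kernel.
- move=> s; rewrite /= in_itv/= andbT => s0.
  rewrite lee_fin [leRHS]normrM (ger0_norm D0) !(normrM (u s)).
  rewrite (ger0_norm (decay_ge0 _ _)).
  rewrite [leRHS]mulrCA ler_wpM2l//.
  exact: subord_kernel_decay C0 hC _ _ _ a0 a1 at1 s0.
Qed.

Lemma is_derive_subordinated n (t : R) : 0 < t ->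
  is_derive t 1 (subordinated n) (subordinated n.+1 t).
Proof.
move=> t0; have [C C0 hC] := subord_kernel_bound n.+1 dl01.
(* A lower bound, capped at 1, for all times in the neighbourhood ]t/2, t+1[ of t. *)
pose a := Num.min 1 (t / 2).
have t20 : 0 < t / 2 by rewrite divr_gt0.
have a0 : 0 < a by rewrite /a lt_min ltr01.
have a1 : a <= 1 by rewrite /a ge_min lexx.
have at1 : a <= t / 2 by rewrite /a ge_min lexx orbT.
(* The exponent dl - (n+1) is at most 0, so the power of time is largest at the left end t/2. *)
pose D := C * ((t / 2) `^ (dl - n.+1%:R) * (a ^+ 2) `^ (- 1 - dl / 2)).
have D0 : 0 <= D by rewrite !mulr_ge0 ?powR_ge0.
pose f t s := u s * subord_kernel n t s.
have df (x s : R) : 0 < s -> is_derive x 1 (f ^~ s) (u s * subord_kernel n.+1 x s).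
  move=> s0; have h := is_derive_subord_kernel n x s0.
  exact: (is_deriveZ (u s) h).
have dfE (x s : R) : 0 < s -> (f ^~ s)^`()%classic x = u s * subord_kernel n.+1 x s.
  by move=> s0; rewrite derive1E; have [_ ->] := df x s s0.
have It : `]t / 2, t + 1[%classic t by rewrite /= in_itv/=; apply/andP; lra.
have pos (x : R) : `]t / 2, t + 1[%classic x -> t / 2 < x.
  by rewrite /= in_itv/= => /andP[].
have H1 (x : R) : `]t / 2, t + 1[%classic x -> mu.-integrable `]0, +oo[ (EFin \o f x).
  by move=> /pos /(lt_trans t20); exact: integrable_subordinated.
have H2 (x s : R) : `]t / 2, t + 1[%classic x -> `]0, +oo[%classic s ->
    derivable (f ^~ s) x 1.
  by rewrite /= !in_itv/= andbT => _ /(df x)[].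
have H3 (s : R) : 0 <= D * `|u s * decay (dl / 2) s| by rewrite mulr_ge0.
have H4 : mu.-integrable `]0, +oo[
    (EFin \o (fun s => D * `|u s * decay (dl / 2) s|)).
  exact: (integrableZl _ D (integrable_norm iu)).
have H5 (x s : R) : `]t / 2, t + 1[%classic x -> `]0, +oo[%classic s ->
    `|partial1of2 f x s| <= D * `|u s * decay (dl / 2) s|.
  move=> /pos tx; rewrite /= in_itv/= andbT => s0.
  rewrite /partial1of2 dfE// !(normrM (u s)) (ger0_norm (decay_ge0 _ _)) [leRHS]mulrCA.
  rewrite ler_wpM2l//; apply: le_trans (subord_kernel_decay C0 hC a0 a1 _ s0) _.
    by rewrite (le_trans at1)// ltW.
  rewrite ler_wpM2r ?decay_ge0// ler_wpM2l// ler_wpM2r ?powR_ge0//.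
  apply: powR_anti => //; first exact: ltW.
  by rewrite subr_le0 (le_trans dl1)// ler1n.
apply: DeriveDef.
  exact: (@derivable_under_integral _ _ _ mu f _ _ t _ _ It H1 H2 _ H3 H4 H5).
rewrite -derive1E.
rewrite (@differentiation_under_integral _ _ _ mu f _ _ t _ _ It H1 H2 _ H3 H4 H5)//.
apply: eq_Rintegral => s; rewrite inE/= in_itv/= andbT => s0.
exact: dfE.
Qed.

Lemma le_subordinated n (C : R) : 0 <= C ->
  (forall t s, 0 < t -> 0 < s -> `|subord_kernel n t s| <=
     C * (t `^ (dl - n%:R) * (s + t ^+ 2) `^ (- 1 - dl / 2))) ->
  forall t, 1 <= t -> `|subordinated n t| <=
    C * t `^ (dl - n%:R) * \int[mu]_(s in `]0, +oo[) `|u s * decay (dl / 2) s|.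
Proof.
move=> C0 hC t t1; have t0 : 0 < t by rewrite (lt_le_trans ltr01).
have iuk := integrable_subordinated n t0.
apply: le_trans (le_normr_Rintegral _ iuk) _ => //.
rewrite -RintegralZl//; last exact: (integrable_norm iu).
apply: le_Rintegral => //.
- exact: (integrable_norm iuk).
- exact: (integrableZl _ _ (integrable_norm iu)).
move=> s; rewrite /= in_itv/= andbT => s0.
rewrite !(normrM (u s)) (ger0_norm (decay_ge0 _ _)) [leRHS]mulrCA ler_wpM2l//.
have := subord_kernel_decay C0 hC ltr01 (lexx 1) t1 s0.
by rewrite expr1n powR1 mulr1.
Qed.

End subordinated.

(** * Comparison of the integrals over t *)

Lemma powR_split (R : realType) (x r s : R) : 0 < x ->
  x `^ (r + s) = x `^ r * x `^ s.
Proof. by move=> x0; rewrite powRD//; apply/implyP => _; rewrite gt_eqF. Qed.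

Lemma powR_le1D (R : realType) (b r q : R) : 0 <= b -> 0 <= r -> r <= q ->
  b `^ r <= 1 + b `^ q.
Proof.
move=> b0 r0 rq; have [b1|b1] := leP b 1.
  apply: (@le_trans _ _ 1); last by rewrite lerDl powR_ge0.
  have -> : 1 = (1 : R) `^ r by rewrite powR1.
  by apply: ge0_ler_powR; rewrite ?nnegrE.
apply: (@le_trans _ _ (b `^ q)); last by rewrite lerDr.
by rewrite ler_powR// ltW.
Qed.

Section smooth_family.
Context (R : realType).
Local Notation mu := (@lebesgue_measure R).
Variable F : nat -> R -> R.
Hypothesis dF : forall n (t : R), 0 < t -> is_derive t 1 (F n) (F n.+1 t).

Lemma smooth_continuous n (t : R) : 0 < t -> {for t, continuous (F n)}.
Proof. by move=> t0; exact: is_derive_continuous (dF n t0). Qed.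

Lemma smooth_measurable n : measurable_fun (`]0%R, +oo[ : set R) (F n).
Proof.
apply: open_continuous_measurable_fun => //.
by move=> t; rewrite inE/= in_itv/= andbT; exact: smooth_continuous.
Qed.

Lemma measurable_invr_pos : measurable_fun (`]0%R, +oo[ : set R) (fun t => t^-1).
Proof.
apply: (eq_measurable_fun (fun t : R => t `^ (-1))).
  by move=> t; rewrite inE/= in_itv/= andbT => /ltW t0; rewrite powR_inv1.
by apply: measurable_funTS; exact: measurable_powR.
Qed.

(** In the application [F n] is the n-th derivative of P_t f(x) in t, and [n] is the order attached
    to the exponent [a]. *)
Definition lp_integrand (n : nat) (a q t : R) : R :=
  (t `^ (n%:R - a) * `|F n t|) `^ q / t.

Lemma lp_integrand_ge0 n a q t : 0 < t -> 0 <= lp_integrand n a q t.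
Proof. by move=> t0; rewrite mulr_ge0 ?powR_ge0// invr_ge0 ltW. Qed.

Lemma measurable_lp_integrand n a q :
  measurable_fun (`]0%R, +oo[ : set R) (lp_integrand n a q).
Proof.
apply: measurable_funM; last exact: measurable_invr_pos.
apply: (measurableT_comp (measurable_powR _)).
apply: measurable_funM; first by apply: measurable_funTS; exact: measurable_powR.
by apply: measurableT_comp => //; exact: smooth_measurable.
Qed.

Lemma smooth_le_integral n (t : R) : 0 < t -> t <= 1 ->
  (`|F n t|%:E <= `|F n 1|%:E + \int[mu]_(u in `[t, 1%R]) `|F n.+1 u|%:E)%E.
Proof.
(* The case t = 1 is set apart because the fundamental theorem is applied on a nondegenerate
   interval. *)
move=> t0; rewrite le_eqVlt => /predU1P[->|t1].
  by rewrite leeDl// integral_ge0.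
have ct u : t <= u -> 0 < u by exact: lt_le_trans.
have FTC : (\int[mu]_(u in `[t, 1%R]) (F n.+1 u)%:E = (F n 1)%:E - (F n t)%:E)%E.
  apply: continuous_FTC2 => //.
  - apply: continuous_in_subspaceT => u; rewrite inE/= in_itv/= => /andP[tu _].
    exact: smooth_continuous (ct _ tu).
  - split.
    + move=> u; rewrite in_itv/= => /andP[/ltW tu _].
      by have [] := dF n (ct _ tu).
    + by apply: cvg_at_right_filter; exact: smooth_continuous.
    + by apply: cvg_at_left_filter; exact: smooth_continuous.
  - move=> u; rewrite in_itv/= => /andP[/ltW tu _]; rewrite derive1E.
    by have [_ ->] := dF n (ct _ tu).
have h : (`|(F n 1)%:E - (F n t)%:E| <= \int[mu]_(u in `[t, 1%R]) `|F n.+1 u|%:E)%E.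
  rewrite -FTC; apply: le_abse_integral => //.
  apply/measurable_EFinP; apply: measurable_funS (smooth_measurable n.+1) => //.
  by move=> u; rewrite /= !in_itv/= andbT => /andP[/ct].
apply: (@le_trans _ _ (`|F n 1|%:E + `|(F n 1)%:E - (F n t)%:E|)%E); last first.
  by rewrite leeD2l.
rewrite -EFinB abse_EFin -EFinD lee_fin.
by have := ler_normB (F n 1) (F n 1 - F n t); rewrite subKr.
Qed.

End smooth_family.

(** * The integral over t, near 0 and at infinity *)

Section calculus.
Context (R : realType).
Local Notation mu := (@lebesgue_measure R).
Variables (C : nat -> R) (dl a1 a2 q1 q2 : R).
Hypotheses (C0 : forall n, 0 <= C n) (q11 : 1 <= q1) (q21 : 1 <= q2).
Hypotheses (q21le : q2 <= q1) (dla2 : dl < a2) (a21 : a2 < a1).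

Let q10 : 0 < q1. Proof. exact: lt_le_trans q11. Qed.
Let q20 : 0 < q2. Proof. exact: lt_le_trans q21. Qed.

(** [C] and [dl] are fixed outside while [F], [A] and [G] vary with f and x, so constants built from
    the former are uniform. [A] is positive because the rescaling divides by it. *)
Definition admissible (k1 : nat) (F : nat -> R -> R) (A G : R) : Prop :=
  [/\ forall n (t : R), 0 < t -> is_derive t 1 (F n) (F n.+1 t),
      forall n t, 1 <= t -> `|F n t| <= C n * t `^ (dl - n%:R) * G,
      0 < A, 0 <= G &
      (\int[mu]_(t in `]0%R, 1%R]) (lp_integrand F k1 a1 q1 t)%:E <=
       (A `^ q1)%:E)%E].

Section fixed_family.
Variables (k1 : nat) (F : nat -> R -> R) (A G : R).
Hypothesis FAG : admissible k1 F A G.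

Let dF : forall n (t : R), 0 < t -> is_derive t 1 (F n) (F n.+1 t).
Proof. by case: FAG. Qed.
Let bF : forall n t, 1 <= t -> `|F n t| <= C n * t `^ (dl - n%:R) * G.
Proof. by case: FAG. Qed.
Let A0 : 0 < A. Proof. by case: FAG. Qed.
Let G0 : 0 <= G. Proof. by case: FAG. Qed.
Let hA : (\int[mu]_(t in `]0%R, 1%R]) (lp_integrand F k1 a1 q1 t)%:E <=
  (A `^ q1)%:E)%E.
Proof. by case: FAG. Qed.

Lemma measurable_powR_shift (c e : R) (D : set R) :
  measurable_fun D (fun t : R => ((c + t) `^ e)%:E).
Proof.
apply/measurable_funTS/measurable_EFinP.
apply: (measurableT_comp (measurable_powR _)).
exact: measurable_funD.
Qed.

(** The factors t^(k-a2) and t^(dl-k) multiply to t^(dl-a2), whatever the order k, and dl < a2 gives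
    convergence. *)
Lemma tail_lp_integral k :
  (\int[mu]_(t in `]1%R, +oo[) (lp_integrand F k a2 q2 t)%:E <=
   ((C k * G) `^ q2 / ((a2 - dl) * q2))%:E)%E.
Proof.
pose e := (a2 - dl) * q2.
have e0 : 0 < e by rewrite mulr_gt0// subr_gt0.
apply: (@le_trans _ _ (\int[mu]_(t in `]1%R, +oo[)
    (((C k * G) `^ q2)%:E * ((0 + t) `^ (- 1 - e))%:E))%E).
  apply: ge0_le_integral => //.
  - move=> t; rewrite /= in_itv/= andbT => t1.
    by rewrite lee_fin lp_integrand_ge0// (lt_trans _ t1).
  - apply/measurable_EFinP.
    apply: measurable_funS (measurable_lp_integrand dF _ _ _) => //.
    by move=> t; rewrite /= !in_itv/= !andbT; exact: lt_trans.
  - by apply: emeasurable_funM => //; exact: measurable_powR_shift.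
  move=> t; rewrite /= in_itv/= andbT => t1; have t0 : 0 < t by exact: lt_trans t1.
  rewrite -EFinM lee_fin add0r /lp_integrand.
  rewrite (powR_split (- 1) (- e) t0) (powRN t 1) powRr1 ?(ltW t0)//.
  rewrite mulrCA mulrC ler_wpM2l ?invr_ge0 ?(ltW t0)//.
  apply: (@le_trans _ _ ((C k * G * t `^ (dl - a2)) `^ q2)).
    apply: ge0_ler_powR; rewrite ?nnegrE ?mulr_ge0 ?powR_ge0 ?(ltW q20)//.
    apply: (@le_trans _ _ (t `^ (k%:R - a2) * (C k * t `^ (dl - k%:R) * G))).
      by rewrite ler_wpM2l ?powR_ge0// bF// ltW.
    rewrite (_ : dl - a2 = (k%:R - a2) + (dl - k%:R)); last by ring.
    rewrite (powR_split (k%:R - a2) (dl - k%:R) t0).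
    by rewrite le_eqVlt; apply/orP; left; apply/eqP; ring.
  rewrite powRM ?powR_ge0 ?mulr_ge0// -powRrM.
  by rewrite (_ : (dl - a2) * q2 = - e) // /e; ring.
rewrite ge0_integralZl//; last 3 first.
- exact: measurable_powR_shift.
- by move=> t _; rewrite lee_fin powR_ge0.
- by rewrite lee_fin powR_ge0.
rewrite integral_itv_obnd_cbnd; last exact: measurable_powR_shift.
by rewrite integral_powRy ?add0r// powR1 -EFinM mul1r.
Qed.

(* Replaces the Hoelder inequality: [b^r <= 1 + b^q], rescaled by [A]. *)
Lemma le_rescaled (b r w v : R) : 0 <= b -> 0 <= r -> r <= q1 -> 0 <= w -> w <= v ->
  b `^ r * w <= A `^ r * (w + v * (A `^ (- q1) * b `^ q1)).
Proof.
move=> b0 r0 rq w0 wv.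
have -> : b `^ r = A `^ r * (b / A) `^ r.
  by rewrite -powRM ?divr_ge0 ?(ltW A0)// mulrC divfK// gt_eqF.
rewrite -mulrA ler_wpM2l ?powR_ge0//.
have -> : A `^ (- q1) * b `^ q1 = (b / A) `^ q1.
  rewrite powRM ?invr_ge0 ?(ltW A0)// mulrC; congr (_ * _).
  by rewrite -powR_inv1 ?(ltW A0)// -powRrM mulN1r.
apply: (@le_trans _ _ ((1 + (b / A) `^ q1) * w)).
  by rewrite ler_wpM2r// powR_le1D// divr_ge0// ltW.
by rewrite mulrDl mul1r lerD2l mulrC ler_wpM2r// powR_ge0.
Qed.

Lemma sub01 (D : set R) : (forall t, D t -> 0 < t) -> D `<=` `]0%R, +oo[%classic.
Proof. by move=> h t /h t0; rewrite /= in_itv/= t0. Qed.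

(* The weight [t^(e-1)] is integrable at 0 and the second summand is
   controlled by [hA]. *)
Lemma integral_rescaled e : 0 < e ->
  (\int[mu]_(t in `]0%R, 1%R]) (t `^ (e - 1) + A `^ (- q1) * lp_integrand F k1 a1 q1 t)%:E
   <= (e^-1 + 1)%:E)%E.
Proof.
move=> e0; under eq_integral do rewrite EFinD EFinM.
have mlp : measurable_fun (`]0%R, 1%R] : set R)
    (fun t => (lp_integrand F k1 a1 q1 t)%:E).
  apply/measurable_EFinP.
    apply: measurable_funS (measurable_lp_integrand dF _ _ _) => //.
  by apply: sub01 => t; rewrite /= in_itv/= => /andP[].
have lp0 t : `]0%R, 1%R]%classic t -> (0 <= (lp_integrand F k1 a1 q1 t)%:E)%E.
  by rewrite /= in_itv/= => /andP[t0 _]; rewrite lee_fin lp_integrand_ge0.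
rewrite ge0_integralD//; last 4 first.
- by move=> t _; rewrite lee_fin powR_ge0.
- by apply/measurable_funTS/measurable_EFinP; exact: measurable_powR.
- by move=> t t01; rewrite mule_ge0 ?lp0// lee_fin powR_ge0.
- exact: emeasurable_funM.
rewrite EFinD leeD//; first exact: integral_powR01.
rewrite ge0_integralZl//; last by rewrite lee_fin powR_ge0.
apply: (@le_trans _ _ ((A `^ (- q1))%:E * (A `^ q1)%:E)%E).
  by rewrite lee_wpmul2l// lee_fin powR_ge0.
by rewrite -EFinM lee_fin -powR_split// addNr powRr0.
Qed.

Lemma head_lp_integral_same :
  (\int[mu]_(t in `]0%R, 1%R]) (lp_integrand F k1 a2 q2 t)%:E <=
   (A `^ q2 * (((a1 - a2) * q2)^-1 + 1))%:E)%E.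
Proof.
pose e := (a1 - a2) * q2.
have e0 : 0 < e by rewrite mulr_gt0// subr_gt0.
have ml k a q : measurable_fun (`]0%R, 1%R] : set R)
    (fun t => (lp_integrand F k a q t)%:E).
  apply/measurable_EFinP.
    apply: measurable_funS (measurable_lp_integrand dF _ _ _) => //.
  by apply: sub01 => t; rewrite /= in_itv/= => /andP[].
have mrhs : measurable_fun (`]0%R, 1%R] : set R)
    (fun t => (t `^ (e - 1) + A `^ (- q1) * lp_integrand F k1 a1 q1 t)%:E).
  apply/measurable_EFinP; apply: measurable_funD.
    by apply: measurable_funTS; exact: measurable_powR.
  by apply: measurable_funM => //; apply/measurable_EFinP; exact: ml.
apply: (@le_trans _ _ (\int[mu]_(t in `]0%R, 1%R])
    ((A `^ q2)%:E * (t `^ (e - 1) + A `^ (- q1) * lp_integrand F k1 a1 q1 t)%:E))%E).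
  apply: ge0_le_integral => //.
  - move=> t; rewrite /= in_itv/= => /andP[t0 _].
    by rewrite lee_fin lp_integrand_ge0.
  - exact: ml.
  - exact: emeasurable_funM.
  move=> t; rewrite /= in_itv/= => /andP[t0 t1].
  rewrite -EFinM lee_fin /lp_integrand.
  have -> : t `^ (k1%:R - a2) * `|F k1 t| =
      (t `^ (k1%:R - a1) * `|F k1 t|) * t `^ (a1 - a2).
    by rewrite (_ : k1%:R - a2 = (k1%:R - a1) + (a1 - a2)) ?powR_split//; ring.
  set b := t `^ (k1%:R - a1) * _.
  have b0 : 0 <= b by rewrite mulr_ge0 ?powR_ge0.
  rewrite powRM ?powR_ge0// -powRrM -/e -mulrA mulrDr.
  (* With r = q2, w = t^e and v = 1: the gain t^e is spent on the constant term only, which makes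
     t^(e-1) integrable at 0; in the other term it is bounded by 1. *)
  have := @le_rescaled b q2 (t `^ e) 1 b0 (ltW q20) q21le (powR_ge0 _ _).
  have te1 : t `^ e <= 1.
    by rewrite -[leRHS](powRr0 t) ger_powR ?t0// ltW.
  move=> /(_ te1); rewrite mul1r => h.
  have ti : 0 <= t^-1 by rewrite invr_ge0 ltW.
  apply: le_trans (le_trans _ (ler_wpM2r ti h)) _.
    by rewrite mulrA.
  rewrite le_eqVlt; apply/orP; left; apply/eqP.
  rewrite (powR_split e (- 1) t0) (powRN t 1) powRr1 ?(ltW t0)//; ring.
rewrite ge0_integralZl//.
- by rewrite EFinM lee_wpmul2l ?lee_fin ?powR_ge0// integral_rescaled.
- move=> t; rewrite /= in_itv/= => /andP[t0 _].
  rewrite lee_fin; apply: addr_ge0; first exact: powR_ge0.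
  by apply: mulr_ge0; [exact: powR_ge0|exact: lp_integrand_ge0].
- by rewrite lee_fin powR_ge0.
Qed.

(** Turns the integral bound on order k1 into a pointwise bound on order k1 - 1. Since b <= m, the
    factor u^(b-m) is at most t^(b-m) on [t, 1] and comes out of the integral, and t^(b-m) >= 1
    absorbs the value at 1. What remains is [le_rescaled] with r = 1 and the gain u^(a1-b). *)
Lemma head_base m b : k1 = m.+1 -> b < a1 -> b <= m%:R ->
  forall t, 0 < t -> t <= 1 ->
    `|F m t| <= (C m + (a1 - b)^-1 + 1) * t `^ (b - m%:R) * (A + G).
Proof.
move=> k1m ba1 bm t t0 t1.
have tbm : 1 <= t `^ (b - m%:R).
  by rewrite -[leLHS](powRr0 t) ger_powR ?t0// subr_le0.
have ab0 : 0 < a1 - b by rewrite subr_gt0.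
have F1 : `|F m 1| <= C m * G by have := bF m (lexx 1); rewrite powR1 mulr1.
suff : (\int[mu]_(u in `[t, 1%R]) `|F m.+1 u|%:E <=
    (A * t `^ (b - m%:R) * ((a1 - b)^-1 + 1))%:E)%E.
  move=> h; have := smooth_le_integral dF m t0 t1.
  move=> /le_trans/(_ (leeD2l _ h)); rewrite -EFinD lee_fin => /le_trans; apply.
  apply: (@le_trans _ _ (C m * t `^ (b - m%:R) * (A + G) +
      ((a1 - b)^-1 + 1) * t `^ (b - m%:R) * (A + G))); last first.
    by rewrite le_eqVlt; apply/orP; left; apply/eqP; ring.
  apply: lerD.
    apply: le_trans F1 _; apply: ler_pM => //.
      by rewrite ler_peMr.
    by rewrite lerDr ltW.
  rewrite [leLHS](_ : _ = ((a1 - b)^-1 + 1) * t `^ (b - m%:R) * A); last by ring.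
  apply: ler_wpM2l; last by rewrite lerDl.
  by rewrite mulr_ge0 ?powR_ge0// addr_ge0// invr_ge0 ltW.
have ml a q : measurable_fun (`]0%R, 1%R] : set R)
    (fun t => (lp_integrand F k1 a q t)%:E).
  apply/measurable_EFinP.
    apply: measurable_funS (measurable_lp_integrand dF _ _ _) => //.
  by apply: sub01 => u; rewrite /= in_itv/= => /andP[].
have mrhs : measurable_fun (`]0%R, 1%R] : set R)
    (fun u => (u `^ ((a1 - b) - 1) + A `^ (- q1) * lp_integrand F k1 a1 q1 u)%:E).
  apply/measurable_EFinP; apply: measurable_funD.
    by apply: measurable_funTS; exact: measurable_powR.
  by apply: measurable_funM => //; apply/measurable_EFinP; exact: ml.
have rhs0 u : `]0%R, 1%R]%classic u ->
    (0 <= (u `^ ((a1 - b) - 1) + A `^ (- q1) * lp_integrand F k1 a1 q1 u)%:E)%E.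
  rewrite /= in_itv/= => /andP[u0 _].
  rewrite lee_fin; apply: addr_ge0; first exact: powR_ge0.
  by apply: mulr_ge0; [exact: powR_ge0|exact: lp_integrand_ge0].
have sub : `[t, 1%R]%classic `<=` `]0%R, 1%R]%classic.
  by move=> u; rewrite /= !in_itv/= => /andP[tu ->]; rewrite (lt_le_trans t0).
have At0 : 0 <= A * t `^ (b - m%:R) by rewrite mulr_ge0 ?powR_ge0// ltW.
apply: (@le_trans _ _ (\int[mu]_(u in `[t, 1%R]) ((A * t `^ (b - m%:R))%:E *
    (u `^ ((a1 - b) - 1) + A `^ (- q1) * lp_integrand F k1 a1 q1 u)%:E))%E).
  apply: ge0_le_integral => //.
  - apply/measurable_EFinP; apply: measurableT_comp => //.
    apply: measurable_funS (smooth_measurable dF m.+1) => //.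
    by apply: sub01 => u; rewrite /= in_itv/= => /andP[/(lt_le_trans t0)].
  - by apply: emeasurable_funM => //; exact: measurable_funS mrhs.
  move=> u; rewrite /= in_itv/= => /andP[tu u1].
  have u0 : 0 < u by exact: lt_le_trans tu.
  rewrite -EFinM lee_fin /lp_integrand -k1m.
  set w := u `^ (k1%:R - a1) * `|F k1 u|.
  have w0 : 0 <= w by rewrite mulr_ge0 ?powR_ge0.
  have uab1 : u `^ (a1 - b) <= 1.
    by rewrite -[leRHS](powRr0 u) ger_powR ?u0// ltW.
  (* Splits off the weight of the hypothesis, the gain u^(a1-b), the measure du/u and the power to
     be pulled out. *)
  have Fw : `|F k1 u| = w * u `^ (a1 - b) / u * u `^ (b - m%:R).
    have E : u `^ (k1%:R - a1) * (u `^ (a1 - b) * (u `^ (- 1) * u `^ (b - m%:R))) = 1.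
      rewrite -(powR_split (- 1) (b - m%:R) u0).
      rewrite -(powR_split (a1 - b) _ u0) -(powR_split (k1%:R - a1) _ u0).
      have -> : k1%:R - a1 + (a1 - b + (- 1 + (b - m%:R))) = 0.
        by rewrite k1m -natr1; ring.
      exact: powRr0.
    rewrite -(powR_inv1 (ltW u0)) /w -[LHS]mul1r -[X in X * _ = _]E; ring.
  have := le_rescaled w0 ler01 q11 (powR_ge0 _ _) uab1.
  rewrite powRr1// powRr1 ?(ltW A0)// mul1r => h.
  have ui : 0 <= u^-1 by rewrite invr_ge0 ltW.
  have utb : u `^ (b - m%:R) <= t `^ (b - m%:R).
    by apply: powR_anti => //; rewrite subr_le0.
  rewrite Fw.
  apply: (@le_trans _ _ (w * u `^ (a1 - b) / u * t `^ (b - m%:R))).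
    by rewrite ler_wpM2l// !mulr_ge0 ?powR_ge0.
  rewrite [leRHS](_ : _ = A * (u `^ (a1 - b) + A `^ (- q1) * w `^ q1) / u *
      t `^ (b - m%:R)).
    by rewrite ler_wpM2r ?powR_ge0// ler_wpM2r.
  rewrite (powR_split (a1 - b) (- 1) u0) (powRN u 1) powRr1 ?(ltW u0)//; ring.
rewrite ge0_integralZl//; last 2 first.
- exact: measurable_funS mrhs.
- by move=> u /sub; exact: rhs0.
rewrite [leRHS]EFinM lee_wpmul2l ?lee_fin//.
apply: le_trans (integral_rescaled ab0).
exact: ge0_subset_integral.
Qed.

(** As b < k, integrating u^(b-k-1) from t produces at most t^(b-k)/(k-b), and t^(b-k) >= 1 absorbs
    the value at 1: the same exponent b passes to the next lower order. *)
Lemma head_step k b c : 0 <= c -> b < k%:R ->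
  (forall u, 0 < u -> u <= 1 -> `|F k.+1 u| <= c * u `^ (b - k.+1%:R) * (A + G)) ->
  forall t, 0 < t -> t <= 1 ->
    `|F k t| <= (C k + c / (k%:R - b)) * t `^ (b - k%:R) * (A + G).
Proof.
move=> c0 bk h t t0 t1.
have tbk : 1 <= t `^ (b - k%:R).
  by rewrite -[leLHS](powRr0 t) ger_powR ?t0// subr_le0 ltW.
have kb0 : 0 < k%:R - b by rewrite subr_gt0.
have AG0 : 0 <= A + G by rewrite addr_ge0// ltW.
have F1 : `|F k 1| <= C k * G by have := bF k (lexx 1); rewrite powR1 mulr1.
have sub : `[t, 1%R]%classic `<=` `[t, +oo[%classic.
  by move=> u; rewrite /= !in_itv/= andbT => /andP[].
suff : (\int[mu]_(u in `[t, 1%R]) `|F k.+1 u|%:E <=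
    (c * (A + G) * (t `^ (b - k%:R) / (k%:R - b)))%:E)%E.
  move=> h2; have := smooth_le_integral dF k t0 t1.
  move=> /le_trans/(_ (leeD2l _ h2)); rewrite -EFinD lee_fin => /le_trans; apply.
  apply: (@le_trans _ _ (C k * t `^ (b - k%:R) * (A + G) +
      c * (A + G) * (t `^ (b - k%:R) / (k%:R - b)))); last first.
    by rewrite le_eqVlt; apply/orP; left; apply/eqP; ring.
  rewrite lerD2r; apply: le_trans F1 _; apply: ler_pM => //.
    by rewrite ler_peMr.
  by rewrite lerDr ltW.
apply: (@le_trans _ _ (\int[mu]_(u in `[t, 1%R])
    ((c * (A + G))%:E * ((0 + u) `^ (- 1 - (k%:R - b)))%:E))%E).
  apply: ge0_le_integral => //.
  - apply/measurable_EFinP; apply: measurableT_comp => //.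
    apply: measurable_funS (smooth_measurable dF k.+1) => //.
    by apply: sub01 => u; rewrite /= in_itv/= => /andP[/(lt_le_trans t0)].
  - by apply: emeasurable_funM => //; exact: measurable_powR_shift.
  move=> u; rewrite /= in_itv/= => /andP[tu u1].
  have u0 : 0 < u by exact: lt_le_trans tu.
  rewrite -EFinM lee_fin add0r; apply: le_trans (h _ u0 u1) _.
  rewrite mulrAC (_ : b - k.+1%:R = - 1 - (k%:R - b))//.
  by rewrite -natr1; ring.
rewrite ge0_integralZl//; last 3 first.
- exact: measurable_powR_shift.
- by move=> u _; rewrite lee_fin powR_ge0.
- by rewrite lee_fin mulr_ge0.
rewrite [leRHS]EFinM lee_wpmul2l ?lee_fin ?mulr_ge0//.
apply: (@le_trans _ _ (\int[mu]_(u in `[t, +oo[)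
   ((0 + u) `^ (- 1 - (k%:R - b)))%:E)%E).
  apply: ge0_subset_integral => //; first exact: measurable_powR_shift.
  by move=> u _; rewrite lee_fin powR_ge0.
by rewrite integral_powRy ?add0r// opprB.
Qed.

(** The pointwise bound leaves t^((b-a2) q2 - 1), integrable at 0 because b > a2. *)
Lemma head_lp_integral_lt k b c : 0 <= c -> a2 < b ->
  (forall t, 0 < t -> t <= 1 -> `|F k t| <= c * t `^ (b - k%:R) * (A + G)) ->
  (\int[mu]_(t in `]0%R, 1%R]) (lp_integrand F k a2 q2 t)%:E <=
   ((c * (A + G)) `^ q2 / ((b - a2) * q2))%:E)%E.
Proof.
move=> c0 ab h.
pose e := (b - a2) * q2.
have e0 : 0 < e by rewrite mulr_gt0// subr_gt0.
have AG0 : 0 <= A + G by rewrite addr_ge0// ltW.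
have mp : measurable_fun (`]0%R, 1%R] : set R) (fun t => (t `^ (e - 1))%:E).
  by apply/measurable_funTS/measurable_EFinP; exact: measurable_powR.
apply: (@le_trans _ _ (\int[mu]_(t in `]0%R, 1%R])
    (((c * (A + G)) `^ q2)%:E * (t `^ (e - 1))%:E))%E).
  apply: ge0_le_integral => //.
  - move=> t; rewrite /= in_itv/= => /andP[t0 _].
    by rewrite lee_fin lp_integrand_ge0.
  - apply/measurable_EFinP.
    apply: measurable_funS (measurable_lp_integrand dF _ _ _) => //.
    by apply: sub01 => t; rewrite /= in_itv/= => /andP[].
  - exact: emeasurable_funM.
  move=> t; rewrite /= in_itv/= => /andP[t0 t1].
  rewrite -EFinM lee_fin /lp_integrand (powR_split e (- 1) t0) (powRN t 1).
  rewrite powRr1 ?(ltW t0)// mulrA ler_wpM2r ?invr_ge0 ?(ltW t0)//.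
  rewrite powRrM -powRM ?mulr_ge0 ?powR_ge0//.
  apply: ge0_ler_powR; rewrite ?nnegrE ?mulr_ge0 ?powR_ge0 ?(ltW q20)//.
  apply: (@le_trans _ _ (t `^ (k%:R - a2) * (c * t `^ (b - k%:R) * (A + G)))).
    by rewrite ler_wpM2l ?powR_ge0// h.
  rewrite (_ : b - a2 = (k%:R - a2) + (b - k%:R)); last by ring.
  rewrite (powR_split (k%:R - a2) (b - k%:R) t0).
  by rewrite le_eqVlt; apply/orP; left; apply/eqP; ring.
rewrite ge0_integralZl//; last 2 first.
- by move=> t _; rewrite lee_fin powR_ge0.
- by rewrite lee_fin powR_ge0.
by rewrite [leRHS]EFinM lee_wpmul2l ?lee_fin ?powR_ge0// integral_powR01.
Qed.

Lemma lp_integral_split k :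
  (\int[mu]_(t in `]0%R, +oo[) (lp_integrand F k a2 q2 t)%:E <=
   \int[mu]_(t in `]0%R, 1%R]) (lp_integrand F k a2 q2 t)%:E +
   \int[mu]_(t in `]1%R, +oo[) (lp_integrand F k a2 q2 t)%:E)%E.
Proof.
have U : `]0%R, +oo[%classic = `]0%R, 1%R]%classic `|` `]1%R, +oo[%classic :> set R.
  by rewrite -itv_bndbnd_setU// bnd_simp.
rewrite U ge0_integral_setU//.
- rewrite -U; apply/measurable_EFinP; exact: measurable_lp_integrand.
- move=> t; rewrite -U /= in_itv/= andbT => t0.
  by rewrite lee_fin lp_integrand_ge0.
- apply/disj_setPS => t [] /=; rewrite !in_itv/= andbT => /andP[_ t1].
  by rewrite ltNge t1.
Qed.

End fixed_family.

(** [j] counts the integrations that lead from order m down to k. The constant is quantified before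
    [F], [A] and [G], hence uniform in f and x. *)
Lemma head_chain m b : b < a1 -> b <= m%:R -> forall j k, (k + j)%N = m -> b < k%:R ->
  exists2 c, 0 <= c & forall F A G, admissible m.+1 F A G ->
    forall t, 0 < t -> t <= 1 -> `|F k t| <= c * t `^ (b - k%:R) * (A + G).
Proof.
move=> ba1 bm; elim=> [|j IH] k kj bk.
  exists (C m + (a1 - b)^-1 + 1).
    by rewrite !addr_ge0// invr_ge0 subr_ge0 ltW.
  move=> F A G FAG t t0 t1; move: FAG bm; rewrite -kj addn0 => FAG bm.
  exact: (head_base FAG).
have bk1 : b < k.+1%:R by rewrite (lt_trans bk)// ltr_nat.
have [|c c0 hc] := IH k.+1 _ bk1; first by rewrite addSnnS.
exists (C k + c / (k%:R - b)).
  by rewrite addr_ge0// divr_ge0// subr_ge0 ltW.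
move=> F A G FAG t t0 t1; apply: (head_step FAG) => // u u0 u1.
exact: hc FAG _ u0 u1.
Qed.

Lemma lp_integral_comparison k1 k2 : a2 < k2%:R -> (k2 <= k1)%N ->
  exists2 D, 0 <= D & forall F A G, admissible k1 F A G ->
    (\int[mu]_(t in `]0%R, +oo[) (lp_integrand F k2 a2 q2 t)%:E <=
     ((D * (A + G)) `^ q2)%:E)%E.
Proof.
move=> a2k2 k21.
have D1 : 0 <= C k2 `^ q2 / ((a2 - dl) * q2).
  by rewrite divr_ge0 ?powR_ge0// mulr_ge0 ?(ltW q20)// subr_ge0 ltW.
suff [K K0 hK] : exists2 K, 0 <= K & forall F A G, admissible k1 F A G ->
    (\int[mu]_(t in `]0%R, 1%R]) (lp_integrand F k2 a2 q2 t)%:E <=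
     (K * (A + G) `^ q2)%:E)%E.
  (* Constants of the head and of the tail; the root of order q2 taken next matches the form of the
     bound. *)
  pose L := K + C k2 `^ q2 / ((a2 - dl) * q2).
  have L0 : 0 <= L by rewrite addr_ge0.
  exists (L `^ q2^-1); first exact: powR_ge0.
  move=> F A G FAG; have [_ _ A0 G0 _] := FAG.
  have AG0 : 0 <= A + G by rewrite addr_ge0// ltW.
  apply: le_trans (lp_integral_split FAG k2) _.
  apply: le_trans (leeD (hK _ _ _ FAG) (tail_lp_integral FAG k2)) _.
  have -> : (L `^ q2^-1 * (A + G)) `^ q2 = L * (A + G) `^ q2.
    by rewrite powRM ?powR_ge0// -powRrM mulVf ?gt_eqF// powRr1.
  rewrite -EFinD lee_fin /L [leRHS]mulrDl lerD2l [leRHS]mulrAC ler_wpM2r//.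
    by rewrite invr_ge0 mulr_ge0 ?(ltW q20)// subr_ge0 ltW.
  rewrite powRM// ler_wpM2l ?powR_ge0//.
  by apply: ge0_ler_powR; rewrite ?nnegrE ?(ltW q20)// lerDr ltW.
(* For equal orders there is nothing to integrate, and the two integrands are compared directly. *)
have [k12|k12] := eqVneq k2 k1.
  exists (((a1 - a2) * q2)^-1 + 1).
    by rewrite addr_ge0// invr_ge0 mulr_ge0 ?(ltW q20)// subr_ge0 ltW.
  move=> F A G FAG; have [_ _ A0 G0 _] := FAG.
  rewrite k12; apply: le_trans (head_lp_integral_same FAG) _.
  rewrite lee_fin mulrC ler_wpM2l//.
    by rewrite addr_ge0// invr_ge0 mulr_ge0 ?(ltW q20)// subr_ge0 ltW.
  by apply: ge0_ler_powR; rewrite ?nnegrE ?addr_ge0 ?(ltW q20) ?(ltW A0)// lerDl.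
have {k12}k21' : (k2 < k1)%N by rewrite ltn_neqAle k12.
case: k1 k21 k21' => // m _; rewrite ltnS => k2m.
(* Any b strictly between a2 and min(a1, k2) would do: b < a1 starts the chain, b < k2 carries it
   down to order k2, and b > a2 makes the final integral converge. *)
pose b := (a2 + Num.min a1 k2%:R) / 2.
have mn : a2 < Num.min a1 k2%:R by rewrite lt_min a21.
have ba1 : b < a1.
  have := mn; have : Num.min a1 k2%:R <= a1 by rewrite ge_min lexx.
  by rewrite /b; lra.
have bk2 : b < k2%:R.
  have := mn; have : Num.min a1 k2%:R <= k2%:R by rewrite ge_min lexx orbT.
  by rewrite /b; lra.
have a2b : a2 < b by rewrite /b; have := mn; lra.
have bm : b <= m%:R by rewrite (le_trans (ltW bk2))// ler_nat.
have [c c0 hc] := head_chain ba1 bm (subnKC k2m) bk2.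
have ba2 : 0 <= ((b - a2) * q2)^-1.
  by rewrite invr_ge0 mulr_ge0 ?(ltW q20)// subr_ge0 ltW.
exists (c `^ q2 / ((b - a2) * q2)); first by rewrite mulr_ge0 ?powR_ge0.
move=> F A G FAG; have [_ _ A0 G0 _] := FAG.
have AG0 : 0 <= A + G by rewrite addr_ge0// ltW.
apply: le_trans (head_lp_integral_lt FAG c0 a2b (hc _ _ _ FAG)) _.
by rewrite lee_fin powRM// mulrAC.
Qed.

End calculus.
(** * Comparison of the square functions *)

Section lower_integral.
Local Open Scope ereal_scope.
Context d (T : measurableType d) (R : realType).
Variable mu : {measure set T -> \bar R}.

Import HBNNSimple.

(** The integral of a nonnegative function is a supremum over the simple functions below it, hence
    monotone even for square functions whose measurability in x is not established. *)
Lemma ge0_le_integral_nonmeasurable (f g : T -> \bar R) :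
  (forall x, 0 <= f x) -> (forall x, f x <= g x) ->
  \int[mu]_x f x <= \int[mu]_x g x.
Proof.
move=> f0 fg; rewrite !ge0_integralTE//; last first.
  by move=> x; exact: le_trans (f0 x) (fg x).
apply: ereal_sup_le => _ [h hf <-]; exists h => // x.
exact: le_trans (hf x) (fg x).
Qed.

(* For non-measurable functions the integral is the lower integral, which is
   subadditive as soon as one of the two summands is measurable. *)
Lemma integral_lty_leD (f g1 g2 : T -> \bar R) (M : R) : (0 <= M)%R ->
  (forall x, 0 <= f x) -> (forall x, 0 <= g1 x) -> (forall x, 0 <= g2 x) ->
  measurable_fun setT g2 -> (forall x, f x <= M%:E * (g1 x + g2 x)) ->
  \int[mu]_x g1 x < +oo -> \int[mu]_x g2 x < +oo -> \int[mu]_x f x < +oo.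
Proof.
move=> M0 f0 g10 g20 mg2 fg ig1 ig2.
(* Unlike [M], this constant can be divided by. *)
pose N := (M + 1)%R; have N0 : (0 < N)%R by rewrite ltr_wpDl.
have fN x : f x <= N%:E * (g1 x + g2 x).
  by rewrite (le_trans (fg x))// lee_wpmul2r ?adde_ge0// lee_fin lerDl.
rewrite (@le_lt_trans _ _ (N%:E * (\int[mu]_x g1 x + \int[mu]_x g2 x)))//; last first.
  by rewrite lte_mul_pinfty ?lee_fin ?(ltW N0)// lte_add_pinfty.
rewrite ge0_integralTE//; apply: ge_ereal_sup => _ [h hf <-].
rewrite -integralT_nnsfun.
(* For a simple h below N (g1 + g2), the positive part of h/N - g2 is measurable, lies below g1, and
   satisfies h <= N (h' + g2). Additivity is then used for the measurable pair [h'], [g2]. *)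
pose h' x := maxe ((N^-1 * h x)%:E - g2 x) 0.
have mh' : measurable_fun setT h'.
  apply: measurable_maxe => //; apply: emeasurable_funB => //.
  by apply/measurable_EFinP; exact: measurable_funM.
have h'0 x : 0 <= h' x by rewrite le_max lexx orbT.
have h'g1 x : h' x <= g1 x.
  rewrite ge_max g10 andbT.
  have [->|g2y] := eqVneq (g2 x) +oo; first by rewrite /= leNye.
  rewrite leeBlDr ?ge0_fin_numE ?ltey//.
  have := le_trans (hf x) (fN x).
  move=> /(lee_wpmul2l (x := N^-1%:E)); rewrite -EFinM muleA -EFinM mulVf ?gt_eqF// mul1e.
  by apply; rewrite lee_fin invr_ge0 ltW.
have hh' x : (h x)%:E <= N%:E * (h' x + g2 x).
  have -> : h x = (N * (N^-1 * h x))%R by rewrite mulrA divff ?mul1r// gt_eqF.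
  rewrite EFinM lee_wpmul2l ?lee_fin ?(ltW N0)//.
  have [->|g2y] := eqVneq (g2 x) +oo.
    by rewrite addey ?leey// gt_eqF// (lt_le_trans _ (h'0 x)).
  by rewrite -leeBlDr ?ge0_fin_numE ?ltey// le_max lexx.
apply: (@le_trans _ _ (\int[mu]_x (N%:E * (h' x + g2 x)))).
  by apply: ge0_le_integral_nonmeasurable => // x; rewrite lee_fin.
rewrite ge0_integralZl//; last 3 first.
- exact: emeasurable_funD.
- by move=> x _; rewrite adde_ge0.
- by rewrite lee_fin ltW.
rewrite lee_wpmul2l ?lee_fin ?(ltW N0)// ge0_integralD//.
by rewrite leeD2r// ge0_le_integral_nonmeasurable.
Qed.

End lower_integral.

(** * Derivatives of the Poisson-Hermite semigroup at a fixed point *)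

Section poisson_hermite_derivatives.
Context (R : realType) (d : nat).
Local Notation mu := (@lebesgue_measure R).
Variables (dl : R) (f : d.-tuple R -> R) (x : d.-tuple R).
Hypotheses (dl01 : 0 < dl <= 1) (mf : measurable_fun setT f).
Let K := decay (dl / 2).
Let u (s : R) := ornstein_uhlenbeck s f x.
Let f1 (y : d.-tuple R) : R := `|f y|.
Hypothesis Gfin : (ou_avg f1 K x < +oo)%E.

Let f10 y : 0 <= f1 y. Proof. exact: normr_ge0. Qed.
Let mf1 : measurable_fun setT f1. Proof. exact: measurableT_comp. Qed.

Let mI : measurable_fun setT (fun s => ou_ge0 f1 s x * (K s)%:E)%E.
Proof.
apply: emeasurable_funM; last by apply/measurable_EFinP; exact: measurable_decay.
exact: (measurableT_comp (measurable_ou_ge0 mf1 f10) (measurable_pair2 x)).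
Qed.

Let int_u_le : (\int[mu]_(s in `]0%R, +oo[) `|u s * K s|%:E <= ou_avg f1 K x)%E.
Proof.
apply: (@le_trans _ _ (\int[mu]_(s in `]0%R, +oo[) (ou_ge0 f1 s x * (K s)%:E))%E).
  apply: ge0_le_integral => //.
  - apply/measurable_EFinP; apply: measurableT_comp => //.
    apply: measurable_funM; first exact: measurable_ornstein_uhlenbeck.
    by apply: measurable_funTS; exact: measurable_decay.
  - exact: measurable_funTS.
  move=> s; rewrite /= in_itv/= andbT => s0.
  rewrite normrM (ger0_norm (decay_ge0 _ _)) EFinM lee_wpmul2r ?lee_fin ?decay_ge0//.
  exact: le_ornstein_uhlenbeck.
apply: ge0_subset_integral => //.
by move=> s _; rewrite mule_ge0 ?ou_ge0_ge0 ?lee_fin ?decay_ge0.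
Qed.

Lemma integrable_ou_decay :
  mu.-integrable `]0, +oo[ (fun s : R => (u s * K s)%:E).
Proof.
apply/integrableP; split.
  apply/measurable_EFinP; apply: measurable_funM.
    exact: measurable_ornstein_uhlenbeck.
  by apply: measurable_funTS; exact: measurable_decay.
exact: le_lt_trans int_u_le Gfin.
Qed.

Lemma le_ou_decay :
  ((\int[mu]_(s in `]0, +oo[) `|u s * K s|)%:E <= ou_avg f1 K x)%E.
Proof.
rewrite /Rintegral fineK//.
have /integrableP[_] := integrable_ou_decay.
by rewrite ge0_fin_numE// integral_ge0.
Qed.

Lemma derive1n_poisson_hermite n (t : R) : 0 < t ->
  ((fun v => poisson_hermite v f x)^`(n))%classic t = subordinated u n t.
Proof.
elim: n t => [|n IH] t t0.
  rewrite derive1n0 /poisson_hermite t0 /subordinated.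
  apply: eq_Rintegral => s; rewrite inE/= in_itv/= andbT => s0.
  by rewrite subord_kernel0.
rewrite derive1nS derive1E.
have dS := is_derive_subordinated dl01 integrable_ou_decay n t0.
rewrite -(@derive_val _ _ _ _ _ _ _ dS); apply: near_eq_derive.
(* The induction hypothesis covers positive times only, which include a neighbourhood of t; this
   determines the derivative there. *)
near=> v; apply: IH; near: v.
exact: lt_nbhsr.
Unshelve. all: end_near. Qed.

End poisson_hermite_derivatives.

(** * Pointwise comparison of the square functions *)

Section littlewood_paley_comparison.
Context (R : realType) (d : nat).
Local Notation mu := (@lebesgue_measure R).

Lemma littlewood_paleyE (alpha q : R) (f : d.-tuple R -> R) (x : d.-tuple R)
    (F : nat -> R -> R) :
  (forall n (t : R), 0 < t ->
     ((fun v => poisson_hermite v f x)^`(n))%classic t = F n t) ->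
  littlewood_paley alpha q f x =
  ((\int[mu]_(t in `]0%R, +oo[)
      (lp_integrand F (smallest_nat_gt alpha) alpha q t)%:E) `^ q^-1)%E.
Proof.
move=> FE; rewrite /littlewood_paley; congr (_ `^ _)%E.
apply: eq_integral => t; rewrite inE => t0.
by rewrite /lp_integrand -FE//; move: t0; rewrite /= in_itv/= andbT.
Qed.

Lemma littlewood_paley_ge0 (alpha q : R) (f : d.-tuple R -> R) x :
  (0 <= littlewood_paley alpha q f x)%E.
Proof. exact: poweR_ge0. Qed.

Lemma powR_add_le (a b r : R) : 0 <= a -> 0 <= b -> 0 <= r ->
  (a + b) `^ r <= 2 `^ r * (a `^ r + b `^ r).
Proof.
move=> a0 b0 r0; wlog ab : a b a0 b0 / a <= b.
  move=> h; have [|/ltW ba] := leP a b; first exact: h.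
  by rewrite addrC (addrC (a `^ r)); exact: h.
apply: (@le_trans _ _ ((2 * b) `^ r)).
  by apply: ge0_ler_powR; rewrite ?nnegrE ?addr_ge0 ?mulr_ge0//; lra.
by rewrite powRM// ler_wpM2l ?powR_ge0// lerDr powR_ge0.
Qed.

Variables (p q1 q2 a1 a2 : R).
Hypotheses (p1 : 1 <= p) (q11 : 1 <= q1) (q21 : 1 <= q2).
Hypotheses (a21 : a2 < a1) (q21le : q2 <= q1).

Lemma littlewood_paley_le (dl : R) : 0 < dl <= 1 -> dl < a2 ->
  exists2 M, 0 <= M & forall (f : d.-tuple R -> R), measurable_fun setT f ->
    forall x, (littlewood_paley a2 q2 f x `^ p <=
      M%:E * (littlewood_paley a1 q1 f x `^ p +
        (ou_avg (fun y => `|f y| `^ p)%R (decay (dl / 2)) x + 1)))%E.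
Proof.
move=> dl01 dla2; have p0 : 0 < p by exact: lt_le_trans p1.
have q10 : 0 < q1 by exact: lt_le_trans q11.
have q20 : 0 < q2 by exact: lt_le_trans q21.
have e0 : 0 < dl / 2 by case/andP: dl01 => dl0 _; rewrite divr_gt0.
have /choice[C hC] : forall n, exists c : R, 0 <= c /\
    forall t s, 0 < t -> 0 < s -> `|subord_kernel n t s| <=
      c * (t `^ (dl - n%:R) * (s + t ^+ 2) `^ (- 1 - dl / 2)).
  by move=> n; have [c c0 hc] := subord_kernel_bound n dl01; exists c.
have C0 n : 0 <= C n by have [] := hC n.
have hCb n := (hC n).2.
pose k1 := smallest_nat_gt a1; pose k2 := smallest_nat_gt a2.
have a2k2 : a2 < k2%:R by exact: truncnS_gt.
have k21 : (k2 <= k1)%N by rewrite ltnS le_truncn// ltW.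
have [D D0 hD] := lp_integral_comparison C0 q11 q21 q21le dla2 a21 a2k2 k21.
pose W : R := (dl / 2)^-1.
have W0 : 0 < W by rewrite invr_gt0.
(* Comes from 1 + l + (W+1) rho <= l + (W+2) rho <= (W+2) (l + rho), where rho >= 1 absorbs the
   1. *)
pose E := D * (W + 2).
have E0 : 0 <= E by rewrite mulr_ge0// addr_ge0// ltW.
(* The added 1 makes the constant positive, so that the right-hand side is +oo as soon as one of its
   terms is. *)
exists ((2 * E) `^ p + 1); first by rewrite addr_ge0// powR_ge0.
move=> f mf x.
have M0 : 0 < (2 * E) `^ p + 1 by rewrite ltr_wpDl// powR_ge0.
set L1 := littlewood_paley a1 q1 f x.
set Gp := ou_avg _ _ x.
have Gp0 : (0 <= Gp)%E.
  by apply: ou_avg_ge0 => [y|s]; [exact: powR_ge0|exact: decay_ge0].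
have L10 : (0 <= L1)%E by exact: littlewood_paley_ge0.
have [L1y|L1fin] := eqVneq L1 +oo%E.
  rewrite L1y poweRyr ?gt_eqF// addye; last first.
    by rewrite -ltNye (lt_le_trans ltNy0)// adde_ge0.
  by rewrite gt0_muley ?lte_fin// leey.
have [Gpy|Gpfin] := eqVneq Gp +oo%E.
  rewrite Gpy addye// addey; last first.
    by rewrite -ltNye (lt_le_trans ltNy0)// poweR_ge0.
  by rewrite gt0_muley ?lte_fin// leey.
have L1E : L1 = (fine L1)%:E by rewrite fineK// ge0_fin_numE// ltey.
have GpE : Gp = (fine Gp)%:E by rewrite fineK// ge0_fin_numE// ltey.
move: (fine L1) (fine Gp) L1E GpE => l r L1E GpE.
have l0 : 0 <= l by rewrite -lee_fin -L1E.
have r0 : 0 <= r by rewrite -lee_fin -GpE.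
have Gle := ou_avg_jensen p1 mf (measurable_decay (dl / 2)) (decay_ge0 (dl / 2))
  (fun s => @decay_le0 R (dl / 2) s) (integral_decay e0) GpE.
have Gfin : (ou_avg (fun y => `|f y|%R) (decay (dl / 2)) x < +oo)%E.
  exact: le_lt_trans Gle (ltry _).
have iu := integrable_ou_decay mf Gfin.
set u := (fun s : R => ornstein_uhlenbeck s f x).
pose G := \int[mu]_(s in `]0, +oo[) `|u s * decay (dl / 2) s|.
have G0 : 0 <= G by exact: Rintegral_ge0.
pose rho := (r + 1) `^ p^-1.
have rho1 : 1 <= rho.
  by rewrite -[leLHS](powRr0 (r + 1)) ler_powR ?lerDr// invr_ge0 ltW.
have Grho : G <= (W + 1) * rho.
  by rewrite -lee_fin; exact: le_trans (le_ou_decay mf Gfin) Gle.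
have FE n (t : R) := @derive1n_poisson_hermite R d dl f x dl01 mf Gfin n t.
(* The value [l] of the square function may be 0, whereas [admissible] asks for a positive bound. *)
pose A := 1 + l.
have A0 : 0 < A by rewrite ltr_pwDl.
have dF n (t : R) : 0 < t -> is_derive t 1 (subordinated u n) (subordinated u n.+1 t).
  by move=> t0; exact: (is_derive_subordinated dl01 iu).
have adm : admissible C dl a1 q1 k1 (subordinated u) A G.
  split => //.
    by move=> n t t1; exact: (le_subordinated dl01 iu (C0 n) (hCb n)).
  apply: (@le_trans _ _ (\int[mu]_(t in `]0%R, +oo[)
      (lp_integrand (subordinated u) k1 a1 q1 t)%:E)%E).
    apply: ge0_subset_integral => //.
    - by apply/measurable_EFinP; exact: measurable_lp_integrand.
    - move=> t; rewrite /= in_itv/= andbT => t0.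
      by rewrite lee_fin lp_integrand_ge0.
    - by move=> t; rewrite /= !in_itv/= andbT => /andP[].
  set I := (\int[mu]_(t in _) _)%E.
  have I0 : (0 <= I)%E.
    apply: integral_ge0 => t; rewrite /= in_itv/= andbT => t0.
    by rewrite lee_fin lp_integrand_ge0.
  have -> : I = (L1 `^ q1)%E.
    by rewrite /L1 (littlewood_paleyE _ _ FE) -poweRrM mulVf ?gt_eqF// poweRe1.
  rewrite L1E poweR_EFin lee_fin.
  apply: ge0_ler_powR; rewrite ?nnegrE ?(ltW q10) ?(ltW A0)//.
  by rewrite lerDr.
have J := hD _ _ _ adm.
have L2 : (littlewood_paley a2 q2 f x <= (D * (A + G))%:E)%E.
  rewrite (littlewood_paleyE _ _ FE).
  have -> : (D * (A + G))%:E = (((D * (A + G)) `^ q2)%:E `^ q2^-1)%E.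
    rewrite poweR_EFin -powRrM mulfV ?gt_eqF// powRr1//.
    by rewrite mulr_ge0// addr_ge0// ltW.
  apply: gt0_ler_poweR J; first by rewrite invr_ge0 ltW.
  - rewrite in_itv/= leey andbT; apply: integral_ge0 => t.
    rewrite /= in_itv/= andbT => t0.
    by rewrite lee_fin lp_integrand_ge0.
  - by rewrite in_itv/= leey andbT lee_fin powR_ge0.
have DE : D * (A + G) <= E * (l + rho).
  rewrite /E -mulrA ler_wpM2l// /A.
  have : 0 <= (W + 1) * l by rewrite mulr_ge0// addr_ge0// ltW.
  by move: Grho rho1; rewrite mulrDl mul1r mulrDr !mulrDl !mul1r; lra.
have lr0 : 0 <= l + rho by rewrite addr_ge0// powR_ge0.
rewrite L1E GpE poweR_EFin; change 1%E with (1%:E : \bar R); rewrite -!EFinD -EFinM.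
apply: (@le_trans _ _ ((E * (l + rho))%:E `^ p)%E).
  apply: gt0_ler_poweR; first exact: ltW.
  - by rewrite in_itv/= leey andbT littlewood_paley_ge0.
  - by rewrite in_itv/= leey andbT lee_fin mulr_ge0.
  - by apply: le_trans L2 _; rewrite lee_fin.
rewrite poweR_EFin lee_fin powRM//.
apply: (@le_trans _ _ ((2 * E) `^ p * (l `^ p + (r + 1)))); last first.
  apply: ler_wpM2r; last by rewrite lerDl.
  by apply: addr_ge0; [exact: powR_ge0|exact: addr_ge0].
rewrite (powRM _ (ler0n _ 2) E0) (mulrC (2 `^ p)) -mulrA ler_wpM2l ?powR_ge0//.
have <- : rho `^ p = r + 1.
  by rewrite /rho -powRrM mulVf ?gt_eqF// powRr1// addr_ge0.
by apply: powR_add_le => //; [exact: powR_ge0|exact: ltW].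
Qed.

End littlewood_paley_comparison.

Theorem proposition2p2 (R : realType) (d : nat) (p q1 q2 alpha1 alpha2 : R)
    (p_ge1 : 1 <= p) (q1_ge1 : 1 <= q1) (q2_ge1 : 1 <= q2)
    (alpha2_gt0 : 0 < alpha2) (alpha2_lt_alpha1 : alpha2 < alpha1)
    (q2_le_q1 : q2 <= q1) :
  triebel_lizorkin d alpha1 p q1 `<=` triebel_lizorkin d alpha2 p q2.
Proof.
move=> f [fL L1fin]; split => //.
have p0 : p != 0 by rewrite gt_eqF// (lt_le_trans ltr01).
have mf : measurable_fun setT f.
  by have /set_mem := sub_Lfun_mfun fL.
have ifp : (\int[gaussian d]_x (`|f x| `^ p)%:E < +oo)%E.
  have /set_mem := sub_Lfun_finLfun fL; rewrite /= /finite_norm => /(poweR_lty p).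
  by rewrite poweR_Lnorm.
(* Halving gives the strict inequality [dl < alpha2]; the minimum with 1 gives [dl <= 1]. *)
pose dl := Num.min 1 alpha2 / 2.
have mn : 0 < Num.min 1 alpha2 by rewrite lt_min ltr01.
have mn1 : Num.min 1 alpha2 <= 1 by rewrite ge_min lexx.
have mn2 : Num.min 1 alpha2 <= alpha2 by rewrite ge_min lexx orbT.
have dl0 : 0 < dl by rewrite divr_gt0.
have dl01 : 0 < dl <= 1 by rewrite dl0/= /dl; lra.
have dla2 : dl < alpha2 by rewrite /dl; lra.
have e0 : 0 < dl / 2 by rewrite divr_gt0.
have [M M0 hM] := @littlewood_paley_le R d p q1 q2 alpha1 alpha2 p_ge1 q1_ge1
  q2_ge1 alpha2_lt_alpha1 q2_le_q1 dl dl01 dla2.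
have mfp : measurable_fun setT (fun y => `|f y| `^ p).
  by apply: (measurableT_comp (measurable_powR p)); exact: measurableT_comp.
have fp0 y : 0 <= `|f y| `^ p by exact: powR_ge0.
have mK := measurable_decay (dl / 2).
have K0 := decay_ge0 (dl / 2).
have mavg := measurable_ou_avg mfp fp0 mK K0.
apply: (@lty_poweRy _ _ p p0); rewrite poweR_Lnorm//.
under eq_integral do rewrite gee0_abs ?littlewood_paley_ge0//.
(* The measurable summand is the average plus 1; the other one is the square function of (alpha1,
   q1). *)
apply: (integral_lty_leD M0 _ _ _ _ (hM f mf)).
- by move=> x; exact: poweR_ge0.
- by move=> x; exact: poweR_ge0.
- by move=> x; rewrite adde_ge0// ou_avg_ge0.
- exact: emeasurable_funD.
- have := poweR_lty p L1fin; rewrite poweR_Lnorm//.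
  by under eq_integral do rewrite gee0_abs ?littlewood_paley_ge0//.
(* The average contributes 2/dl times the integral of |f|^p, and the constant 1 contributes the
   total mass of the Gaussian measure. *)
- rewrite ge0_integralD//; last by move=> x _; rewrite ou_avg_ge0.
  rewrite integral_ou_avg//; last exact: decay_le0.
  rewrite integral_decay// integral_cst// mul1e.
  apply: lte_add_pinfty; first by rewrite lte_mul_pinfty// lee_fin invr_ge0 ltW.
  by have := gaussian_setT R d; rewrite /= => ->; rewrite ltry.
Qed.
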